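(* Fix $h>0$, $\gamma>0$ and $\beta>0$, let $b(y)=-y^3+\beta y$ and $a(h):=\gamma\sqrt{h/2}$. Let $Y_h^c(x),Y_{h/2}^f(x)$ be the coupled coarse and fine tamed Euler updates and $\tilde X_h^c(x),\tilde X_{h/2}^f(x)$ the coupled coarse and fine skew-symmetric updates started from $x$ (defined in the context from independent standard Gaussians $U_1,U_2,V_1,V_2,G_1,G_2$). Then, as $x\to\infty$, the following limits hold. (i) Tamed Euler. $$\frac{Y_{h/2}^f(x)-Y_h^c(x)}{x}\to a(h)^2G_1G_2\quad\text{in }L^2,$$ and hence $$\mathbb{V}_{\mathrm{te}}(h):=\lim_{x\to\infty}\frac1{x^2}\mathrm{Var}\bigl(Y_{h/2}^f(x)-Y_h^c(x)\bigr)=a(h)^4.$$ (ii) Skew-symmetric scheme. $$\frac{\tilde X_{h/2}^f(x)-\tilde X_h^c(x)}{x}\to a(h)\bigl(|U_1+U_2|-|U_1|-|U_2|\bigr)+a(h)^2|U_1||U_2|\quad\text{in }L^2,$$ and hence $$\mathbb{V}_{\mathrm{sk}}(h):=\lim_{x\to\infty}\frac1{x^2}\mathrm{Var}\bigl(\tilde X_{h/2}^f(x)-\tilde X_h^c(x)\bigr)=\left(2-\frac{16}{\pi}+\frac{8\sqrt2}{\pi}\right)a(h)^2+2\left(\frac{-4-\pi+4\sqrt2}{\pi^{3/2}}\right)a(h)^3+\left(1-\frac{4}{\pi^2}\right)a(h)^4.$$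
   Context: The underlying model is the one-dimensional stochastic Ginzburg–Landau SDE $\mathrm{d}X_t=(-X_t^3+\beta X_t)\,\mathrm{d}t+\gamma X_t\,\mathrm{d}W_t$ with $\beta,\gamma>0$. Let $U_1,U_2,V_1,V_2,G_1,G_2$ be independent standard Gaussian random variables and $$U_c=\frac{U_1+U_2}{\sqrt2},\quad V_c=\frac{V_1+V_2}{\sqrt2},\quad G_c=\frac{G_1+G_2}{\sqrt2}.$$ Tamed Euler: for $\eta>0$, $T_\eta(y;G):=y+\frac{\eta b(y)}{1+\eta|b(y)|}+\gamma y\sqrt\eta\,G$. Coarse and fine updates: $$Y_h^c(x):=T_h(x;G_c),\qquad Y_{h/2}^f(x):=T_{h/2}\bigl(T_{h/2}(x;G_1);G_2\bigr).$$ Skew-symmetric: for $\eta>0$, let $\tilde\alpha(\eta,y):=\sqrt{\frac{\pi}{2}}\sqrt\eta\,\frac{b(y)}{\gamma y}$ (with $b(y)/y=\beta-y^2$, also at $y=0$), $\beta_\eta(y):=\frac1{\sqrt{1+\tilde\alpha(\eta,y)^2}}$, $\delta_\eta(y):=\frac{\tilde\alpha(\eta,y)}{\sqrt{1+\tilde\alpha(\eta,y)^2}}$, and $$S_\eta(y;U,V):=y+\gamma y\sqrt\eta\bigl(\beta_\eta(y)V+\delta_\eta(y)|U|\bigr).$$ Coarse and fine updates: $$\tilde X_h^c(x):=S_h(x;U_c,V_c),\qquad \tilde X_{h/2}^f(x):=S_{h/2}\bigl(S_{h/2}(x;U_1,V_1);U_2,V_2\bigr).$$ *)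

(* Defs.v *)
From HB Require Import structures.
From mathcomp Require Import all_boot all_order all_algebra.
From mathcomp Require Import all_classical all_reals all_analysis.
Set Implicit Arguments.
Unset Strict Implicit.
Unset Printing Implicit Defensive.
Import Order.TTheory GRing.Theory Num.Theory.
Import numFieldNormedType.Exports.

Local Open Scope classical_set_scope.
Local Open Scope ring_scope.

Section Probability.
Context d (T : measurableType d) (R : realType) (P : probability T R).

(* The law is compared on measurable sets only: [distribution P X] and
   [normal_prob 0 1] are total functions on [set R] whose values elsewhere are
   meaningless. The second parameter of [normal_prob] is the standard
   deviation. *)
Definition standard_gaussian (X : {RV P >-> R}) : Prop :=
  forall A : set R, measurable A -> distribution P X A = normal_prob 0 1 A.

Definition mutually_independent (I : finType) (X : I -> {RV P >-> R}) : Prop :=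
  forall (J : {set I}) (B : I -> set R), (forall i, measurable (B i)) ->
    P (\bigcap_(i in [set` J]) (X i @^-1` B i)) =
    (\prod_(i in J) P (X i @^-1` B i))%E.

Definition cvg_in_Lp (p : \bar R) (I : Type) (F : set_system I)
    (X : I -> T -> R) (Z : T -> R) : Prop :=
  [/\ \forall i \near F, X i \in Lfun P p,
      Z \in Lfun P p &
      'N[P]_p[EFin \o (X i \- Z)%R]%E @[i --> F] --> 0%E].

End Probability.

Section Schemes.
Context (R : realType) (beta gamma : R).

Definition drift (y : R) : R := - y ^+ 3 + beta * y.

Definition tamed_step (eta y g : R) : R :=
  y + eta * drift y / (1 + eta * `|drift y|) + gamma * y * Num.sqrt eta * g.

(* [drift y / y], extended continuously to y = 0 *)
Definition drift_ratio (y : R) : R := beta - y ^+ 2.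

Lemma drift_ratioE (y : R) : y != 0 -> drift_ratio y = drift y / y.
Proof.
by move=> y0; rewrite /drift_ratio /drift mulrDl mulNr (exprSr y 2) !mulfK// addrC.
Qed.

Definition skew_alpha (eta y : R) : R :=
  Num.sqrt (pi / 2) * Num.sqrt eta * (drift_ratio y / gamma).

Definition skew_beta (eta y : R) : R :=
  1 / Num.sqrt (1 + skew_alpha eta y ^+ 2).

Definition skew_delta (eta y : R) : R :=
  skew_alpha eta y / Num.sqrt (1 + skew_alpha eta y ^+ 2).

Definition skew_step (eta y u v : R) : R :=
  y + gamma * y * Num.sqrt eta * (skew_beta eta y * v + skew_delta eta y * `|u|).

Context (T : Type).

Definition coarse_noise (Z1 Z2 : T -> R) (w : T) : R := (Z1 w + Z2 w) / Num.sqrt 2.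

Definition tamed_coarse (h : R) (G1 G2 : T -> R) (x : R) (w : T) : R :=
  tamed_step h x (coarse_noise G1 G2 w).

Definition tamed_fine (h : R) (G1 G2 : T -> R) (x : R) (w : T) : R :=
  tamed_step (h / 2) (tamed_step (h / 2) x (G1 w)) (G2 w).

Definition skew_coarse (h : R) (U1 U2 V1 V2 : T -> R) (x : R) (w : T) : R :=
  skew_step h x (coarse_noise U1 U2 w) (coarse_noise V1 V2 w).

Definition skew_fine (h : R) (U1 U2 V1 V2 : T -> R) (x : R) (w : T) : R :=
  skew_step (h / 2) (skew_step (h / 2) x (U1 w) (V1 w)) (U2 w) (V2 w).

Definition tamed_diff (h : R) (G1 G2 : T -> R) (x : R) (w : T) : R :=
  tamed_fine h G1 G2 x w - tamed_coarse h G1 G2 x w.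

Definition skew_diff (h : R) (U1 U2 V1 V2 : T -> R) (x : R) (w : T) : R :=
  skew_fine h U1 U2 V1 V2 x w - skew_coarse h U1 U2 V1 V2 x w.

Definition noise_scale (h : R) : R := gamma * Num.sqrt (h / 2).

End Schemes.

(* Main.v *)
Require Import Defs.
From HB Require Import structures.
From mathcomp Require Import all_boot all_order all_algebra.
From mathcomp Require Import all_classical all_reals all_analysis.
From mathcomp Require Import measurable_realfun ring lra.
Import Order.TTheory GRing.Theory Num.Theory.
Import numFieldNormedType.Exports.
Set Implicit Arguments.
Unset Strict Implicit.
Unset Printing Implicit Defensive.

Local Open Scope classical_set_scope.
Local Open Scope ring_scope.

(** The starting point x goes to infinity, where the drift is huge and the two
    schemes react to it in opposite ways.

    The tamed drift increment is bounded by 1 in absolute value, so one step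
    is x (1 + a G) up to a bounded error.  Two fine steps give
    x (1 + a G1) (1 + a G2) and one coarse step gives x (1 + a (G1 + G2));
    only the cross term a^2 G1 G2 survives the difference.  In the skew scheme
    the drift enters through the skewness of the noise: far from the origin
    skew_beta tends to 0 and skew_delta to -1, so one step is x (1 - a |U|).
    Two fine steps give x (1 - a |U1|) (1 - a |U2|), one coarse step gives
    x (1 - a |U1 + U2|), since a sqrt 2 is the noise scale of the coarse step,
    and the difference is x times the announced limit.

    In both cases the error is controlled for every outcome at once: the
    difference divided by x is within W / x of the limit, with a square
    integrable W that is the same for all x ([tamed_rate], [skew_rate]).  For
    the skew scheme the intermediate point y is random and may be close to 0
    or negative; what makes the bound uniform is that y * skew_beta y and
    y * (1 + skew_delta y) are bounded over all real y
    ([skew_error_bound]).  Such a rate gives convergence in L^2 and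
    convergence of the variances ([rate_cvg_in_Lp2], [rate_cvg_variance]), so
    it remains to compute the variances of the two limits.

    For G1 G2 this is immediate.  For the skew limit put A = |U1 + U2|,
    B = |U1| and C = |U2|.  Replacing U2 by - U2 preserves the joint law, and
    |x + y| + |x - y| = 2 max (|x|, |y|); hence A may be replaced by max (B, C)
    in the mean of A times any function of B and C
    ([has_mean_gaussian_reflect], [normD_normB_max]).  The means needed then
    are those of max (B, C), max (B, C)^2 and max (B, C) min (B, C)^2.  With f
    the density of |U1|, integrating first over the larger variable uses only
    the tail integrals of x f and of x^2 f beyond c, which are f c and
    c f c + (the tail integral of f), and leaves one-dimensional integrals of
    f^2, a Gaussian function ([ge0_integral_normal2_max_min]). *)

(** * Gaussian integrals over half-lines *)

Section half_line.
Context {R : realType}.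
Notation mu := (@lebesgue_measure R).

(** The fundamental theorem of calculus on a half-line for a derivative f - g of
    no constant sign: the integrals of f and g over bounded intervals converge
    monotonically, and the integral of g is finite, so it may be subtracted. *)
Lemma ge0_continuous_FTC2y_sub (f g F : R -> R) (a l : R) :
  (forall x, a <= x -> 0 <= f x) -> (forall x, a <= x -> 0 <= g x) ->
  continuous f -> continuous g ->
  (forall x, is_derive x (1:R) F (f x - g x)) ->
  F x @[x --> +oo] --> l ->
  (\int[mu]_(x in `[a, +oo[) (g x)%:E < +oo)%E ->
  (\int[mu]_(x in `[a, +oo[) (f x)%:E =
   \int[mu]_(x in `[a, +oo[) (g x)%:E + (l - F a)%:E)%E.
Proof.
move=> f0 g0 cf cg dF Fl goo.
have cF : continuous F.
  by move=> x; apply/differentiable_continuous/derivable1_diffP; case: (dF x).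
have itvE : `[a, +oo[%classic = \bigcup_n `[a, a + n%:R]%classic.
  apply/seteqP; split=> x/=; last first.
    by move=> [n _]/=; rewrite !in_itv/= andbT => /andP[].
  rewrite in_itv/= andbT => ax.
  have xa0 : 0 <= x - a by rewrite subr_ge0.
  exists (Num.truncn (x - a)).+1 => //=; rewrite in_itv/= ax/=.
  by rewrite -lerBlDl ltW// truncnS_gt.
have lim (h : R -> R) : (forall x, a <= x -> 0 <= h x) -> continuous h ->
    (\int[mu]_(x in `[a, (a + n%:R)%R]) (h x)%:E)%E @[n --> \oo] -->
    (\int[mu]_(x in `[a, +oo[) (h x)%:E)%E.
  move=> h0 ch; rewrite itvE; apply: ge0_nondecreasing_set_cvg_integral => //.
  - move=> m n mn; rewrite subsetEset => x/=.
    rewrite !in_itv/= => /andP[-> /le_trans]; apply.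
    by rewrite lerD2l ler_nat.
  - move=> n; apply/measurable_EFinP/measurable_funTS.
    exact: continuous_measurable_fun.
  - by move=> n x/=; rewrite in_itv/= => /andP[ax _]; rewrite lee_fin h0.
have ih (h : R -> R) n : continuous h -> mu.-integrable `[a, a + n%:R] (EFin \o h).
  move=> ch; apply: continuous_compact_integrable; first exact: segment_compact.
  exact: continuous_subspaceT.
have eqn : \forall n \near \oo,
    (\int[mu]_(x in `[a, (a + n%:R)%R]) (g x)%:E + (F (a + n%:R) - F a)%:E =
     \int[mu]_(x in `[a, (a + n%:R)%R]) (f x)%:E)%E.
  near=> n.
  have n0 : a < a + n%:R.
    by rewrite ltrDl ltr0n; near: n; exact: nbhs_infty_gt.
  have := @continuous_FTC2 R (fun x => f x - g x) F a (a + n%:R) n0.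
  rewrite EFinB => <-.
  - rewrite [X in (_ + X)%E](integralB_EFin _ (ih _ _ cf) (ih _ _ cg))//.
    by rewrite addeC subeK//; exact: (integrable_fin_num _ (ih g n cg)).
  - by apply: continuous_subspaceT => x; apply: continuousB; [exact: cf|exact: cg].
  - split.
    + by move=> x _; case: (dF x).
    + by apply: cvg_at_right_filter; exact: cF.
    + by apply: cvg_at_left_filter; exact: cF.
  - by move=> x _; rewrite derive1E; exact: derive_val.
have L1 := lim f f0 cf.
have L2 : (\int[mu]_(x in `[a, (a + n%:R)%R]) (g x)%:E +
    (F (a + n%:R) - F a)%:E)%E @[n --> \oo] -->
    (\int[mu]_(x in `[a, +oo[) (g x)%:E + (l - F a)%:E)%E.
  apply: cvgeD.
  - exact: fin_num_adde_defl.
  - exact: lim.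
  - apply: cvg_EFin; first by near=> n.
    apply: cvgB; last exact: cvg_cst.
    have aoo : a + n%:R @[n --> \oo] --> +oo.
      exact: (cvg_comp _ _ cvgr_idn (cvg_addrl a)).
    exact: (cvg_comp _ _ aoo Fl).
have L3 := cvg_trans (near_eq_cvg eqn) L2.
exact: (cvg_unique _ L1 (L3 _)).
Unshelve. all: by end_near. Qed.

(** The density of a standard normal variable is a multiple of this function at
    s = 1/2, its square a multiple of this function at s = 1. *)
Definition gaussian (s x : R) : R := expR (- (s * x ^+ 2)).

Lemma gaussian_ge0 s x : 0 <= gaussian s x.
Proof. exact: expR_ge0. Qed.

Lemma is_derive_gaussian s x :
  is_derive x (1 : R) (gaussian s) (- (2 * s * x) * gaussian s x).
Proof.
have d1 := is_deriveX 2 (is_derive_id x (1 : R)).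
have d2 := is_deriveN (is_deriveZ s d1).
have d3 := is_derive1_comp (is_derive_expR _) d2.
apply: (is_derive_eq d3).
rewrite /GRing.scale/= /gaussian.
rewrite (_ : (- (s \*: id ^+ 2)) x = - (s * x ^+ 2))//; ring.
Qed.

Lemma continuous_gaussian s : continuous (gaussian s).
Proof.
move=> x; apply/differentiable_continuous/derivable1_diffP.
by case: (is_derive_gaussian s x).
Qed.

Lemma measurable_gaussian s (D : set R) : measurable_fun D (gaussian s).
Proof.
apply: measurable_funTS; apply: continuous_measurable_fun.
exact: continuous_gaussian.
Qed.

(** From exp (s x^2) >= 1 + s x^2, the product is at most 1 / (s x). *)
Lemma cvg_idM_gaussian (s : R) : 0 < s -> x * gaussian s x @[x --> +oo] --> (0 : R).
Proof.
move=> s0.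
apply: (@squeeze_cvgr _ _ _ _ (cst 0) (fun x => s^-1 * x^-1)).
- near=> x.
  have x0 : 0 < x by near: x; exact: nbhs_pinfty_gt.
  rewrite mulr_ge0 ?gaussian_ge0 ?(ltW x0)//=.
  rewrite /gaussian expRN ler_pdivrMr ?expR_gt0// -invfM ler_pdivlMl ?mulr_gt0//.
  have := expR_ge1Dx (s * x ^+ 2); rewrite (_ : s * x * x = s * x ^+ 2); last by ring.
  lra.
- exact: cvg_cst.
- rewrite -(mulr0 s^-1); apply: cvgM; first exact: cvg_cst.
  rewrite gtr0_cvgV0; first exact: cvg_id.
  by near=> x; near: x; exact: nbhs_pinfty_gt.
Unshelve. all: by end_near. Qed.

Lemma cvg_gaussian (s : R) : 0 < s -> gaussian s x @[x --> +oo] --> (0 : R).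
Proof.
move=> s0.
apply: (@squeeze_cvgr _ _ _ _ (cst 0) (fun x => x * gaussian s x)).
- near=> x.
  have x1 : 1 < x by near: x; exact: nbhs_pinfty_gt.
  by rewrite gaussian_ge0/= ler_peMl ?gaussian_ge0// ltW.
- exact: cvg_cst.
- exact: cvg_idM_gaussian.
Unshelve. all: by end_near. Qed.

(** The integrand is the derivative of - gaussian s x / (2 s). *)
Lemma integral_idM_gaussian_tail (s c : R) : 0 < s -> 0 <= c ->
  (\int[mu]_(x in `[c, +oo[) (x * gaussian s x)%:E =
   ((2 * s)^-1 * gaussian s c)%:E)%E.
Proof.
move=> s0 c0.
have s2 : 2 * s != 0 by rewrite mulf_neq0// gt_eqF.
have dF x : is_derive x (1 : R) 
    (fun x => - ((2 * s)^-1 * gaussian s x)) (x * gaussian s x).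
  have d := is_deriveN (is_deriveZ (2 * s)^-1 (is_derive_gaussian s x)).
  apply: (is_derive_eq d).
  by rewrite /GRing.scale/=; field; rewrite gt_eqF.
rewrite (@ge0_continuous_FTC2y _ _ (fun x => - ((2 * s)^-1 * gaussian s x)) c 0).
- by rewrite sub0e -EFinN opprK.
- by move=> x cx; rewrite mulr_ge0 ?gaussian_ge0 ?(le_trans c0).
- apply: continuous_subspaceT => x; apply: continuousM; first exact: cvg_id.
  exact: continuous_gaussian.
- rewrite -oppr0 -(mulr0 (2 * s)^-1); apply: cvgN; apply: cvgM; first exact: cvg_cst.
  exact: cvg_gaussian.
- by move=> x _; case: (dF x).
- apply: cvg_at_right_filter; apply: cvgN; apply: cvgM; first exact: cvg_cst.
  exact: continuous_gaussian.
- by move=> x _; rewrite derive1E; exact: derive_val.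
Qed.

(** The derivative of - x gaussian s x is 2 s x^2 gaussian s x - gaussian s x,
    which changes sign; hence the use of the theorem for a difference. *)
Lemma integral_sqrM_gaussian_tail (s c : R) : 0 < s ->
  (\int[mu]_(x in `[c, +oo[) (gaussian s x)%:E < +oo)%E ->
  ((2 * s)%:E * \int[mu]_(x in `[c, +oo[) (x ^+ 2 * gaussian s x)%:E =
   \int[mu]_(x in `[c, +oo[) (gaussian s x)%:E + (c * gaussian s c)%:E)%E.
Proof.
move=> s0 woo.
rewrite -ge0_integralZl_EFin//; last 3 first.
- by move=> x _; rewrite lee_fin mulr_ge0 ?gaussian_ge0// sqr_ge0.
- apply/measurable_EFinP/measurable_funM; first exact: exprn_measurable.
  exact: measurable_gaussian.
- by rewrite mulr_ge0// ltW.
have dF x : is_derive x (1 : R) (fun x => - (x * gaussian s x))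
    (2 * s * (x ^+ 2 * gaussian s x) - gaussian s x).
  have d := is_deriveN (is_deriveM (is_derive_id x (1 : R)) (is_derive_gaussian s x)).
  apply: (is_derive_eq d).
  by rewrite /GRing.scale/=; ring.
rewrite -[(c * _)%R]opprK -[X in (_ + X%:E)%E]add0r.
rewrite -(@ge0_continuous_FTC2y_sub (fun x => 2 * s * (x ^+ 2 * gaussian s x)) _
  (fun x => - (x * gaussian s x))).
- by [].
- by move=> x _; rewrite mulr_ge0 ?(mulr_ge0 (sqr_ge0 x)) ?gaussian_ge0//
    ?mulr_ge0 ?(ltW s0).
- by move=> x _; exact: gaussian_ge0.
- move=> x; apply: cvgM; first exact: cvg_cst.
  by apply: cvgM; [exact: exprn_continuous|exact: continuous_gaussian].
- exact: continuous_gaussian.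
- by rewrite -oppr0; apply: cvgN; exact: cvg_idM_gaussian.
- exact: woo.
Qed.

End half_line.

(** * Integrals against the standard normal law *)

Section half_normal.
Context {R : realType}.
Notation mu := (@lebesgue_measure R).
Notation N01 := (@normal_prob R 0 1).

(** The density on [0, +oo[ of the absolute value of a standard normal
    variable. *)
Definition half_normal_pdf (x : R) : R := Num.sqrt (2 / pi) * gaussian 2^-1 x.

Lemma half_normal_pdf_ge0 x : 0 <= half_normal_pdf x.
Proof. by rewrite mulr_ge0 ?sqrtr_ge0 ?gaussian_ge0. Qed.

Lemma continuous_half_normal_pdf : continuous half_normal_pdf.
Proof.
move=> x; apply: cvgM; first exact: cvg_cst.
exact: continuous_gaussian.
Qed.

Lemma measurable_half_normal_pdf D : measurable_fun D half_normal_pdf.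
Proof.
apply: measurable_funTS; apply: continuous_measurable_fun.
exact: continuous_half_normal_pdf.
Qed.

Lemma normal_pdf01E (x : R) :
  normal_pdf 0 1 x = normal_peak 1 * gaussian 2^-1 x.
Proof.
rewrite normal_pdfE ?oner_neq0//; congr (_ * expR _).
by rewrite subr0; field.
Qed.

Lemma half_normal_pdfE x : half_normal_pdf x = 2 * normal_pdf 0 1 x.
Proof.
rewrite normal_pdf01E mulrA; congr (_ * _).
rewrite /normal_peak expr1n mul1r -[pi *+ 2]mulr_natr.
move: (pi_gt0 R); move: (pi : R) => p p0.
apply/eqP; rewrite -(@eqrXn2 _ 2) ?sqrtr_ge0 ?mulr_ge0 ?invr_ge0 ?sqrtr_ge0//.
rewrite exprMn exprVn !sqr_sqrtr ?mulr_ge0 ?invr_ge0 ?(ltW p0)//.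
by apply/eqP; field; rewrite gt_eqF.
Qed.

Lemma sqr_half_normal_pdf x : half_normal_pdf x ^+ 2 = 2 / pi * gauss_fun x.
Proof.
rewrite exprMn sqr_sqrtr ?divr_ge0 ?pi_ge0//; congr (_ * _).
by rewrite /gaussian /gauss_fun expr2 -expRD; congr expR; field.
Qed.

Lemma normal_pdf_even (x : R) : normal_pdf 0 1 (- x) = normal_pdf 0 1 x.
Proof. by rewrite !normal_pdf01E /gaussian sqrrN. Qed.

(** The density is the Radon-Nikodym derivative of the law, because both have
    the same integral over every measurable set. *)
Lemma ge0_integral_normal_prob (f : R -> \bar R) :
  measurable_fun setT f -> (forall x, 0 <= f x)%E ->
  (\int[N01]_x f x = \int[mu]_x (f x * (normal_pdf 0 1 x)%:E))%E.
Proof.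
move=> mf f0.
have dom := @normal_prob_dominates R 0 1.
rewrite -(Radon_Nikodym_SigmaFinite.change_of_variables dom f0 measurableT mf).
have irn := Radon_Nikodym_SigmaFinite.f_integrable dom.
apply: ae_eq_integral => //.
- apply: emeasurable_funM => //; exact: (measurable_int _ irn).
- apply: emeasurable_funM => //; apply/measurable_EFinP.
  exact: measurable_normal_pdf.
- apply: ae_eqe_mul2l; apply: integral_ae_eq => //.
  + by apply/measurable_EFinP; exact: measurable_normal_pdf.
  + by move=> E _ mE; rewrite -Radon_Nikodym_SigmaFinite.f_integral.
Qed.

Lemma ge0_integral_lebesgueN (f : R -> \bar R) :
  measurable_fun setT f -> (forall x, 0 <= f x)%E ->
  (\int[mu]_x f (- x)%R = \int[mu]_x f x)%E.
Proof.
move=> mf f0.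
rewrite [RHS](eq_measure_integral
    (pushforward mu (-%R : _ -> measurableTypeR R))); last first.
  by move=> A mA _; exact/esym/lebesgue_measureN.
by rewrite ge0_integral_pushforward.
Qed.

Lemma ge0_integral_normal_probN (f : R -> \bar R) :
  measurable_fun setT f -> (forall x, 0 <= f x)%E ->
  (\int[N01]_x f (- x)%R = \int[N01]_x f x)%E.
Proof.
move=> mf f0.
rewrite !ge0_integral_normal_prob//; last by apply: measurableT_comp.
have := @ge0_integral_lebesgueN (fun x => f x * (normal_pdf 0 1 x)%:E)%E.
move=> <-.
- by apply: eq_integral => x _; rewrite normal_pdf_even.
- apply: emeasurable_funM => //; apply/measurable_EFinP.
  exact: measurable_normal_pdf.
- by move=> x; rewrite mule_ge0// lee_fin normal_pdf_ge0.
Qed.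

(** The two half-lines contribute equally by symmetry, which doubles the
    density. *)
Lemma ge0_integral_normal_prob_norm (f : R -> \bar R) :
  measurable_fun setT f -> (forall x, (0 <= x)%R -> 0 <= f x)%E ->
  (\int[N01]_x f `|x|%R =
   \int[mu]_(x in `[0%R, +oo[) (f x * (half_normal_pdf x)%:E))%E.
Proof.
move=> mf f0.
have mfa : measurable_fun setT (fun x : R => f `|x|).
  by apply: measurableT_comp => //; exact: normr_measurable.
rewrite ge0_integral_normal_prob//; last by move=> x; exact: f0.
pose h x : \bar R := (f `|x|%R * (normal_pdf 0 1 x)%:E)%E.
have mh : measurable_fun setT h.
  apply: emeasurable_funM => //; apply/measurable_EFinP.
  exact: measurable_normal_pdf.
have h0 x : (0 <= h x)%E by rewrite mule_ge0 ?f0// lee_fin normal_pdf_ge0.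
have hN x : h (- x) = h x by rewrite /h normrN normal_pdf_even.
rewrite -[LHS]/(\int[mu]_x h x)%E.
have -> : [set: R] = `]-oo, 0] `|` `]0, +oo[.
  apply/seteqP; split=> x//= _; rewrite !in_itv/= andbT.
  by case: (leP x 0); [left|right].
rewrite ge0_integral_setU//=; last 2 first.
- by apply: measurable_funTS.
- by apply/disj_setPS => x /= []; rewrite !in_itv/= andbT leNgt => /negP.
rewrite (_ : \int[mu]_(x in `]-oo, 0%R]) h x =
    \int[mu]_(x in `[0%R, +oo[) h x)%E; last first.
  rewrite [RHS](ge0_integration_by_substitution0 mh h0).
  by apply: eq_integral => x _; rewrite hN.
rewrite integral_itv_obnd_cbnd; last exact: measurable_funTS.
rewrite -ge0_integralD//; [|exact: measurable_funTS..].
apply: eq_integral => x; rewrite inE/= in_itv/= andbT => x0.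
rewrite half_normal_pdfE /h ger0_norm// mulr_natl mulr2n EFinD.
by rewrite ge0_muleDr// lee_fin normal_pdf_ge0.
Qed.

End half_normal.

Section tails.
Context {R : realType}.
Notation mu := (@lebesgue_measure R).
Notation N01 := (@normal_prob R 0 1).
Notation f := (@half_normal_pdf R).

Definition half_normal_tail (u : R -> R) (c : R) : \bar R :=
  (\int[mu]_(x in `[c, +oo[) (u x * f x)%:E)%E.

(** The normalization of the half-normal density: both sides are the total mass
    of the standard normal law. *)
Lemma half_normal_tail_mass : half_normal_tail (cst 1) 0 = 1%E.
Proof.
rewrite /half_normal_tail.
have := @ge0_integral_normal_prob_norm R (cst 1%E).
rewrite integral_cst//= probability_setT mul1e => ->//.
Qed.

Lemma integral_gaussian_half_lty (c : R) : 0 <= c ->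
  (\int[mu]_(x in `[c, +oo[) (gaussian 2^-1 x)%:E < +oo)%E.
Proof.
move=> c0.
have k0 : 0 < Num.sqrt (2 / pi) :> R by rewrite sqrtr_gt0 divr_gt0 ?pi_gt0.
have mg D : measurable_fun D (EFin \o gaussian (2^-1 : R)).
  by apply/measurable_EFinP; exact: measurable_gaussian.
apply: (@le_lt_trans _ _ (\int[mu]_(x in `[0%R, +oo[) (gaussian 2^-1 x)%:E)%E).
  apply: ge0_subset_integral => //=; [exact: mg| |].
    by move=> x _; rewrite lee_fin gaussian_ge0.
  by move=> x /=; rewrite !in_itv/= !andbT; exact: le_trans.
have := half_normal_tail_mass; rewrite /half_normal_tail.
under eq_integral do rewrite mul1r EFinM.
rewrite ge0_integralZl_EFin//=; last 2 first.
- by move=> x _; rewrite lee_fin gaussian_ge0.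
- exact: mg.
set I := integral _ _ _; case: I => [r _||]//; first exact: ltry.
by rewrite gt0_muley ?lte_fin.
Qed.

Lemma half_normal_tail_id (c : R) : 0 <= c -> half_normal_tail id c = (f c)%:E.
Proof.
move=> c0; rewrite /half_normal_tail.
transitivity (\int[mu]_(x in `[c, +oo[)
    ((Num.sqrt (2 / pi))%:E * (x * gaussian 2^-1 x)%:E))%E.
  by apply: eq_integral => x _; rewrite -EFinM mulrCA.
rewrite ge0_integralZl_EFin ?sqrtr_ge0//; last 2 first.
- move=> x /=; rewrite in_itv/= andbT => cx.
  by rewrite lee_fin mulr_ge0 ?gaussian_ge0 ?(le_trans c0).
- apply/measurable_EFinP/measurable_funM; first exact: measurable_id.
  exact: measurable_gaussian.
rewrite integral_idM_gaussian_tail// -EFinM; congr (_ * _)%:E.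
by rewrite mulfV// invr1 mul1r.
Qed.

(** Integration by parts with f' (x) = - x f (x). *)
Lemma half_normal_tail_sqr (c : R) : 0 <= c ->
  half_normal_tail (fun x => x ^+ 2) c =
  (half_normal_tail (cst 1%R) c + (c * f c)%:E)%E.
Proof.
move=> c0; rewrite /half_normal_tail.
have mg D : measurable_fun D (gaussian (2^-1 : R)).
  exact: measurable_gaussian.
have k0 : 0 <= Num.sqrt (2 / pi) :> R by rewrite sqrtr_ge0.
have sqr_tail := integral_sqrM_gaussian_tail (s := 2^-1) (c := c).
rewrite mulfV// mul1e in sqr_tail.
transitivity (\int[mu]_(x in `[c, +oo[)
    ((Num.sqrt (2 / pi))%:E * (x ^+ 2 * gaussian 2^-1 x)%:E))%E.
  by apply: eq_integral => x _; rewrite -EFinM mulrCA.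
rewrite ge0_integralZl_EFin//; last 2 first.
- by move=> x _; rewrite lee_fin mulr_ge0 ?gaussian_ge0 ?sqr_ge0.
- by apply/measurable_EFinP/measurable_funM; [exact: exprn_measurable|exact: mg].
rewrite sqr_tail ?invr_gt0//; last exact: integral_gaussian_half_lty.
rewrite ge0_muleDr//; last 2 first.
- by apply: integral_ge0 => x _; rewrite lee_fin gaussian_ge0.
- by rewrite lee_fin mulr_ge0 ?gaussian_ge0.
congr (_ + _)%E; last by rewrite -EFinM mulrCA.
rewrite -ge0_integralZl_EFin//.
- by apply: eq_integral => x _; rewrite mul1r.
- by move=> x _; rewrite lee_fin gaussian_ge0.
- by apply/measurable_EFinP; exact: mg.
Qed.

Lemma integral_sqr_half_normal_pdf (v : R -> R) :
  measurable_fun setT v -> (forall x, 0 <= x -> 0 <= v x) ->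
  (\int[N01]_y (v `|y| * f `|y|)%:E =
   (2 / pi)%:E * \int[mu]_(y in `[0%R, +oo[) (v y * gauss_fun y)%:E)%E.
Proof.
move=> mv v0.
have mgf := @measurable_gauss_fun R.
rewrite (@ge0_integral_normal_prob_norm _ (fun y => (v y * f y)%:E)); last 2 first.
- by apply/measurable_EFinP/measurable_funM => //; exact: measurable_half_normal_pdf.
- by move=> x x0; rewrite lee_fin mulr_ge0 ?v0 ?half_normal_pdf_ge0.
transitivity (\int[mu]_(y in `[0%R, +oo[) ((2 / pi)%:E * (v y * gauss_fun y)%:E))%E.
  apply: eq_integral => x _.
  by rewrite -!EFinM [in RHS]mulrCA -sqr_half_normal_pdf -mulrA -expr2.
rewrite ge0_integralZl_EFin//.
- move=> x /=; rewrite in_itv/= andbT => x0.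
  by rewrite lee_fin mulr_ge0 ?v0 ?gauss_fun_ge0.
- by apply/measurable_EFinP/measurable_funM; exact: measurable_funTS.
- by rewrite divr_ge0 ?pi_ge0.
Qed.

End tails.

(** * The larger and the smaller of two absolute values *)

Section two_gaussians.
Context {R : realType}.
Notation mu := (@lebesgue_measure R).
Notation N01 := (@normal_prob R 0 1).
Notation N2 := (N01 \x N01)%E.
Notation f := (@half_normal_pdf R).

(** The boolean selects a strict or a nonstrict comparison: when a pair of
    numbers is ordered, ties must be attributed to exactly one of the two
    cases, and the tail integral does not see the difference. *)
Lemma ge0_integral_normal_tail (b : bool) (u : R -> R) (c : R) :
  measurable_fun setT u -> (forall x, 0 <= x -> 0 <= u x) -> 0 <= c ->
  (\int[N01]_x (u `|x| * (c < `|x| ?<= if b)%:R)%:E = half_normal_tail u c)%E.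
Proof.
move=> mfu u0 c0.
have mi : measurable_fun setT (fun x : R => (c < x ?<= if b)%:R : R).
  rewrite (_ : (fun _ => _) = \1_[set` Interval (BSide b c) +oo%O]).
    exact: measurable_indic.
  apply/funext => x; rewrite indicE; congr (nat_of_bool _)%:R.
  by apply/idP/idP; rewrite inE/= in_itv/= andbT; case: b.
rewrite (@ge0_integral_normal_prob_norm _ 
    (fun x => (u x * (c < x ?<= if b)%:R)%:E)); last 2 first.
- by apply/measurable_EFinP/measurable_funM.
- by move=> x x0; rewrite lee_fin mulr_ge0 ?u0.
transitivity (\int[mu]_(x in [set` Interval (BSide b c) +oo%O]) (u x * f x)%:E)%E.
  rewrite integral_mkcond [RHS]integral_mkcond; apply: eq_integral => x _.
  rewrite !patchE !mem_setE !in_itv/= !andbT -EFinM.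
  case: ifPn => x0; case: ifPn => cx; rewrite ?mulr1 ?mulr0 ?mul0r//.
  by move: x0; rewrite (le_trans c0)//; move: cx; clear mi; case: b => //= /ltW.
clear mi; case: b => //; rewrite integral_itv_obnd_cbnd//.
apply/measurable_EFinP/measurable_funTS/measurable_funM => //.
exact: measurable_half_normal_pdf.
Qed.

Lemma ge0_integral_normal2_yx (G : R * R -> R) :
  measurable_fun setT G -> (forall z, 0 <= G z) ->
  (\int[N2]_z (G z)%:E = \int[N01]_y \int[N01]_x (G (x, y))%:E)%E.
Proof.
by move=> mG G0; rewrite fubini_tonelli2//; exact/measurable_EFinP.
Qed.

Lemma ge0_integral_normal2_xy (G : R * R -> R) :
  measurable_fun setT G -> (forall z, 0 <= G z) ->
  (\int[N2]_z (G z)%:E = \int[N01]_x \int[N01]_y (G (x, y))%:E)%E.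
Proof.
by move=> mG G0; rewrite fubini_tonelli1//; exact/measurable_EFinP.
Qed.

Lemma ge0_integral_normal2_swap (G : R * R -> R) :
  measurable_fun setT G -> (forall z, 0 <= G z) ->
  (\int[N2]_z (G (z.2, z.1))%:E = \int[N2]_z (G z)%:E)%E.
Proof.
move=> mG G0.
rewrite ge0_integral_normal2_yx//; last first.
  by apply: measurableT_comp => //; apply/measurable_fun_pair.
by rewrite ge0_integral_normal2_xy.
Qed.

Lemma measurable_abs_lteif (b : bool) :
  measurable_fun setT (fun z : R * R => (`|z.2| < `|z.1| ?<= if b)%:R : R).
Proof.
have m1 : measurable_fun setT (fun z : R * R => `|z.1|).
  by apply: measurableT_comp; [exact: normr_measurable|exact: measurable_fst].
have m2 : measurable_fun setT (fun z : R * R => `|z.2|).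
  by apply: measurableT_comp; [exact: normr_measurable|exact: measurable_snd].
have mb : measurable_fun setT (fun z : R * R => `|z.2| < `|z.1| ?<= if b).
  by case: b => /=; [exact: measurable_fun_ler|exact: measurable_fun_ltr].
rewrite (_ : (fun _ => _) = \1_[set z : R * R | `|z.2| < `|z.1| ?<= if b]).
  apply: measurable_indic; rewrite -[X in measurable X]setTI.
  exact: (mb measurableT [set true]).
apply/funext => z; rewrite indicE; congr (nat_of_bool _)%:R.
by apply/idP/idP; rewrite inE.
Qed.

(** The tail is the partial integral of a jointly measurable function, so the
    measurability half of the theorem of Tonelli applies. *)
Lemma measurable_half_normal_tail (u : R -> R) :
  measurable_fun setT u -> (forall x, 0 <= x -> 0 <= u x) ->
  measurable_fun setT (fun y : R => half_normal_tail u `|y|).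
Proof.
move=> mfu u0.
pose G (z : R * R) := (u `|z.1| * (`|z.2| < `|z.1| ?<= if true)%:R)%:E.
rewrite (_ : (fun _ => _) = fubini_G N01 G).
  apply: measurable_fun_fubini_tonelli_G => [|z].
    apply/measurable_EFinP/measurable_funM; last exact: measurable_abs_lteif.
    apply: (measurableT_comp mfu); apply: measurableT_comp.
      exact: normr_measurable.
    exact: measurable_fst.
  by rewrite lee_fin mulr_ge0 ?u0.
by apply/funext => y; rewrite -(ge0_integral_normal_tail true mfu u0).
Qed.

(** Split the plane according to which coordinate has the larger absolute value.
    On each part integrate that coordinate first: its range is the half-line
    beyond the absolute value of the other one.  The two parts contribute
    equally. *)
Lemma ge0_integral_normal2_max_min (u v : R -> R) :
  measurable_fun setT u -> measurable_fun setT v ->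
  (forall x, 0 <= x -> 0 <= u x) -> (forall x, 0 <= x -> 0 <= v x) ->
  (\int[N2]_z (u (Num.max `|z.1| `|z.2|) * v (Num.min `|z.1| `|z.2|))%:E =
   2%:E * \int[N01]_y ((v `|y|)%:E * half_normal_tail u `|y|))%E.
Proof.
move=> mfu mv u0 v0.
pose G b (z : R * R) : R := u `|z.1| * v `|z.2| * (`|z.2| < `|z.1| ?<= if b)%:R.
have m1 : measurable_fun setT (fun z : R * R => `|z.1|).
  by apply: measurableT_comp; [exact: normr_measurable|exact: measurable_fst].
have m2 : measurable_fun setT (fun z : R * R => `|z.2|).
  by apply: measurableT_comp; [exact: normr_measurable|exact: measurable_snd].
have mG b : measurable_fun setT (G b).
  apply: measurable_funM.
    by apply: measurable_funM; [exact: (measurableT_comp mfu)|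
      exact: (measurableT_comp mv)].
  exact: measurable_abs_lteif.
have G0 b z : 0 <= G b z by rewrite /G !mulr_ge0 ?u0 ?v0.
have IG b : (\int[N2]_z (G b z)%:E =
    \int[N01]_y ((v `|y|)%:E * half_normal_tail u `|y|))%E.
  rewrite ge0_integral_normal2_yx//; apply: eq_integral => y _.
  rewrite -(@ge0_integral_normal_tail b)// -ge0_integralZl_EFin ?v0//.
  - by apply: eq_integral => x _; rewrite -EFinM /G/= mulrCA mulrA.
  - by move=> x _; rewrite lee_fin mulr_ge0 ?u0.
  - apply/measurable_EFinP/measurable_funM.
      by apply: measurableT_comp => //; exact: normr_measurable.
    exact: (measurable_fun_pair1 _ (@measurable_abs_lteif b)).
transitivity (\int[N2]_z ((G true z)%:E + (G false (z.2, z.1))%:E))%E.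
  apply: eq_integral => z _; rewrite -EFinD /G /=.
  by case: leP; rewrite ?mulr1 ?mulr0 ?addr0 ?add0r.
rewrite ge0_integralD//=; last 4 first.
- by move=> z _; rewrite lee_fin.
- by apply/measurable_EFinP; exact: mG.
- by move=> z _; rewrite lee_fin.
- apply/measurable_EFinP; apply: (measurableT_comp (mG false)).
  exact/measurable_fun_pair.
rewrite ge0_integral_normal2_swap// !IG.
by rewrite mule_natl mule2n.
Qed.

End two_gaussians.

Section gauss_moments.
Context {R : realType}.
Notation mu := (@lebesgue_measure R).
Notation N01 := (@normal_prob R 0 1).
Notation N2 := (N01 \x N01)%E.

Lemma ge0_integral_normal_prob_comp_norm (u : R -> R) :
  measurable_fun setT u -> (forall x, 0 <= x -> 0 <= u x) ->
  (\int[N01]_x (u `|x|)%:E = half_normal_tail u 0)%E.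
Proof.
move=> mfu u0; rewrite (@ge0_integral_normal_prob_norm _ (EFin \o u))//.
exact/measurable_EFinP.
Qed.

Lemma half_normal_tail_id0 : half_normal_tail id (0 : R) = (Num.sqrt (2 / pi))%:E.
Proof.
rewrite half_normal_tail_id// /half_normal_pdf /gaussian.
by rewrite expr0n/= mulr0 oppr0 expR0 mulr1.
Qed.

Lemma half_normal_tail_sqr0 : half_normal_tail (fun x => x ^+ 2) (0 : R) = 1%E.
Proof. by rewrite half_normal_tail_sqr// half_normal_tail_mass mul0r adde0. Qed.

Lemma gaussian1 : gaussian (1 : R) = gauss_fun.
Proof. by apply/funext => x; rewrite /gaussian mul1r. Qed.

Lemma integral_idM_gauss_fun :
  (\int[mu]_(y in `[0%R, +oo[) (y * gauss_fun y)%:E = (2^-1)%:E)%E.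
Proof.
have := @integral_idM_gaussian_tail R 1 0 ltr01 (lexx _).
rewrite gaussian1.
by move=> ->; rewrite /gauss_fun expr0n/= oppr0 expR0 !mulr1.
Qed.

Lemma integral_sqrM_gauss_fun :
  (\int[mu]_(y in `[0%R, +oo[) (y ^+ 2 * gauss_fun y)%:E = (Num.sqrt pi / 4)%:E)%E.
Proof.
have := @integral_sqrM_gaussian_tail R 1 0 ltr01.
rewrite gaussian1 integral0y_gauss ltry => /(_ isT).
rewrite mulr1 mul0r adde0.
set I := integral _ _ _; case: I => [r [h]||]/=.
- by congr EFin; move: h; lra.
- by rewrite gt0_muley ?lte_fin.
- by rewrite gt0_muleNy ?lte_fin.
Qed.

Lemma ge0_integral_normal2_prod (u v : R -> R) :
  measurable_fun setT u -> measurable_fun setT v ->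
  (forall x, 0 <= x -> 0 <= u x) -> (forall x, 0 <= x -> 0 <= v x) ->
  (\int[N2]_z (u `|z.1| * v `|z.2|)%:E =
   half_normal_tail u 0 * half_normal_tail v 0)%E.
Proof.
move=> mfu mv u0 v0.
have mua : measurable_fun setT (fun x : R => u `|x|).
  by apply: measurableT_comp => //; exact: normr_measurable.
have mva : measurable_fun setT (fun x : R => v `|x|).
  by apply: measurableT_comp => //; exact: normr_measurable.
rewrite (@ge0_integral_normal2_yx _
    (fun z : R * R => u `|z.1| * v `|z.2|)); last 2 first.
- apply: measurable_funM.
    by apply: (measurableT_comp mua); exact: measurable_fst.
  by apply: (measurableT_comp mva); exact: measurable_snd.
- by move=> z; rewrite mulr_ge0 ?u0 ?v0.
transitivity (\int[N01]_y (half_normal_tail u 0 * (v `|y|)%:E))%E.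
  apply: eq_integral => y _ /=.
  rewrite -ge0_integral_normal_prob_comp_norm// muleC -ge0_integralZl_EFin ?v0//.
  - by apply: eq_integral => x _; rewrite -EFinM mulrC.
  - by move=> x _; rewrite lee_fin u0.
  - exact/measurable_EFinP.
rewrite ge0_integralZl//.
- by rewrite ge0_integral_normal_prob_comp_norm.
- exact/measurable_EFinP.
- by move=> x _; rewrite lee_fin v0.
- rewrite -ge0_integral_normal_prob_comp_norm//.
  by apply: integral_ge0 => x _; rewrite lee_fin u0.
Qed.

(** The tail of x f beyond c is f c, which leaves twice the integral of f^2. *)
Lemma integral_normal2_max :
  (\int[N2]_z (Num.max `|z.1| `|z.2|)%:E = (2 / Num.sqrt pi)%:E)%E.
Proof.
have := @ge0_integral_normal2_max_min R id (cst 1) (@measurable_id _ _ _)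
  (@measurable_cst _ _ _ _ _ _) (fun x h => h) (fun x _ => ler01).
under eq_integral do rewrite mulr1.
move=> ->.
under eq_integral do rewrite half_normal_tail_id// -EFinM.
rewrite (integral_sqr_half_normal_pdf (v := cst 1))//.
under eq_integral do rewrite mul1r.
rewrite integral0y_gauss -!EFinM; congr EFin.
have p0 : 0 < Num.sqrt pi :> R by rewrite sqrtr_gt0 pi_gt0.
rewrite -[in 2 / pi](@sqr_sqrtr _ pi) ?pi_ge0//.
by field; rewrite gt_eqF.
Qed.

Lemma integral_normal2_max_sqr_min :
  (\int[N2]_z (Num.max `|z.1| `|z.2| * (Num.min `|z.1| `|z.2|) ^+ 2)%:E =
   (1 / Num.sqrt pi)%:E)%E.
Proof.
have := @ge0_integral_normal2_max_min R id (fun x => x ^+ 2) (@measurable_id _ _ _)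
  (exprn_measurable _) (fun x h => h) (fun x _ => sqr_ge0 x).
move=> ->.
under eq_integral do rewrite half_normal_tail_id// -EFinM.
rewrite (integral_sqr_half_normal_pdf (exprn_measurable _) (fun x _ => sqr_ge0 x)).
rewrite integral_sqrM_gauss_fun -!EFinM; congr EFin.
have p0 : 0 < Num.sqrt pi :> R by rewrite sqrtr_gt0 pi_gt0.
rewrite -[in 2 / pi](@sqr_sqrtr _ pi) ?pi_ge0//.
by field; rewrite gt_eqF.
Qed.

(** The tail of x^2 f beyond c is c f c plus the tail of f.  The first term
    contributes twice the integral of c f^2; the second one contributes 1,
    because it is what the same decomposition of the plane yields for the
    constant function 1. *)
Lemma integral_normal2_sqr_max :
  (\int[N2]_z ((Num.max `|z.1| `|z.2|) ^+ 2)%:E = (1 + 2 / pi)%:E)%E.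
Proof.
have h1 := @ge0_integral_normal2_max_min R (cst 1) (cst 1)
  (@measurable_cst _ _ _ _ _ _)
  (@measurable_cst _ _ _ _ _ _) (fun x _ => ler01) (fun x _ => ler01).
have := @ge0_integral_normal2_max_min R (fun x => x ^+ 2) (cst 1)
  (exprn_measurable _)
  (@measurable_cst _ _ _ _ _ _) (fun x _ => sqr_ge0 x) (fun x _ => ler01).
under eq_integral do rewrite mulr1.
move=> ->.
under eq_integral do rewrite mul1e half_normal_tail_sqr//.
rewrite ge0_integralD//; last 4 first.
- move=> y _; apply: integral_ge0 => x _.
  by rewrite lee_fin mul1r half_normal_pdf_ge0.
- exact: measurable_half_normal_tail.
- by move=> y _; rewrite lee_fin mulr_ge0 ?half_normal_pdf_ge0.
- apply/measurable_EFinP/measurable_funM; first exact: normr_measurable.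
  by apply: measurableT_comp; [exact: measurable_half_normal_pdf|exact: normr_measurable].
rewrite (integral_sqr_half_normal_pdf (v := id))//.
rewrite integral_idM_gauss_fun.
rewrite ge0_muleDr//; last 2 first.
- apply: integral_ge0 => y _; apply: integral_ge0 => x _.
  by rewrite lee_fin mul1r half_normal_pdf_ge0.
- by rewrite lee_fin mulr_ge0 ?divr_ge0 ?pi_ge0.
rewrite [RHS]EFinD; congr (_ + _)%E; last by rewrite -!EFinM mulrCA mulfV ?mulr1.
move: h1; under [in RHS]eq_integral do rewrite mul1e; move=> <-.
under eq_integral do rewrite /= mulr1.
by rewrite integral_cst//= probability_setT mule1.
Qed.

End gauss_moments.

(** * Means and square integrability *)

Section means.
Context d (T : measurableType d) (R : realType) (P : probability T R).

(** Integrability is part of the predicate so that means of linear combinations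
    can be computed term by term. *)
Definition has_mean (Z : T -> R) (m : R) : Prop :=
  Z \in Lfun P 1 /\ 'E_P[Z]%E = m%:E.

Lemma ge0_has_mean (Z : T -> R) (m : R) : measurable_fun setT Z ->
  (forall w, 0 <= Z w) -> (\int[P]_w (Z w)%:E = m%:E)%E -> has_mean Z m.
Proof.
move=> mZ Z0 Zm; split; last by rewrite unlock.
apply/Lfun1_integrable/integrableP; split; first exact/measurable_EFinP.
under eq_integral do rewrite /= ger0_norm//.
by rewrite Zm ltry.
Qed.

Lemma has_mean_ge0 (Z : T -> R) (m : R) : has_mean Z m ->
  (\int[P]_w (Z w)%:E = m%:E)%E.
Proof. by case=> _; rewrite unlock. Qed.

Lemma has_mean_eq (Z Z' : T -> R) (m m' : R) :
  has_mean Z m -> Z =1 Z' -> m = m' -> has_mean Z' m'.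
Proof. by move=> Zm /funext <- <-. Qed.

Lemma has_meanD (Y Z : T -> R) (m n : R) :
  has_mean Y m -> has_mean Z n -> has_mean (fun w => Y w + Z w) (m + n).
Proof.
move=> [Y1 mY] [Z1 mZ]; split; first exact: rpredD.
by rewrite expectationD// mY mZ.
Qed.

Lemma has_meanZ (k : R) (Z : T -> R) (m : R) :
  has_mean Z m -> has_mean (fun w => k * Z w) (k * m).
Proof.
move=> [Z1 mZ].
have -> : (fun w => k * Z w) = k \o* Z by apply/funext => w /=; rewrite mulrC.
by split; [exact: Lfun_scale|rewrite expectationZl// mZ].
Qed.

Lemma has_meanB (Y Z : T -> R) (m n : R) :
  has_mean Y m -> has_mean Z n -> has_mean (fun w => Y w - Z w) (m - n).
Proof.
move=> [Y1 mY] [Z1 mZ]; split; first exact: rpredB.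
by rewrite expectationB// mY mZ.
Qed.

Lemma sqr_Lfun2 (Z : T -> R) : measurable_fun setT Z ->
  (fun w => Z w ^+ 2) \in Lfun P 1 -> Z \in Lfun P 2%:E.
Proof.
move=> mZ /Lfun1_integrable/integrableP[_ Z2].
rewrite inE; apply/andP; split; rewrite inE//=.
rewrite /finite_norm unlock /Lnorm poweR_lty//.
apply: le_lt_trans Z2; rewrite le_eqVlt; apply/orP; left; apply/eqP.
apply: eq_integral => w _ /=.
by rewrite powR_mulrn// normrX.
Qed.

Lemma has_mean_Lfun2 (Z : T -> R) (m : R) : measurable_fun setT Z ->
  has_mean (fun w => Z w ^+ 2) m -> Z \in Lfun P 2%:E.
Proof. by move=> mZ [Z2 _]; exact: sqr_Lfun2. Qed.

Lemma has_mean_variance (Z : T -> R) (m v : R) : measurable_fun setT Z ->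
  has_mean Z m -> has_mean (fun w => Z w ^+ 2) v -> 'V_P[Z]%E = (v - m ^+ 2)%:E.
Proof.
move=> mZ [_ Zm] Z2; rewrite varianceE; last exact: has_mean_Lfun2 Z2.
by rewrite Zm (_ : 'E_P[Z ^+ 2]%E = v%:E)//; case: Z2.
Qed.

End means.

(** * Laws of one and of two independent standard Gaussian variables *)

Section pair_law.
Context d (T : measurableType d) (R : realType) (P : probability T R).
Notation N01 := (@normal_prob R 0 1).
Notation N2 := (N01 \x N01)%E.

Definition independent_pair (X Y : {RV P >-> R}) : Prop :=
  forall A B : set R, measurable A -> measurable B ->
    (P (X @^-1` A `&` Y @^-1` B) = P (X @^-1` A) * P (Y @^-1` B))%E.

Lemma mutually_independent_pair (I : finType) (X : I -> {RV P >-> R}) (i j : I) :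
  mutually_independent X -> i != j -> independent_pair (X i) (X j).
Proof.
move=> indX ij A B mA mB.
have := indX [set i; j]%SET (fun k => if k == i then A else B).
rewrite big_setU1 ?inE//= big_set1 eqxx eq_sym (negbTE ij) => <-; last first.
  by move=> k; case: ifP.
congr (P _); apply/seteqP; split => w /=.
  move=> [Aw Bw] k /=; rewrite !inE => /orP[|] /eqP ->; first by rewrite eqxx.
  by rewrite eq_sym (negbTE ij).
move=> h; split.
  by have := h i; rewrite /= !inE eqxx/= => /(_ isT).
by have := h j; rewrite /= !inE eqxx/= orbT eq_sym (negbTE ij) => /(_ isT).
Qed.

Section gaussian_law.
Variable X : {RV P >-> R}.
Hypothesis gX : standard_gaussian X.

Let X' (w : T) : measurableTypeR R := X w.
Let mX' : measurable_fun setT X'.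
Proof.
have mX : measurable_fun setT X by [].
by move=> mT A mA; exact: mX.
Qed.

HB.instance Definition _ := isMeasurableFun.Build _ _ _ _ X' mX'.

Lemma ge0_integral_gaussian (g : R -> \bar R) :
  measurable_fun setT g -> (forall x, 0 <= g x)%E ->
  (\int[P]_w g (X w) = \int[N01]_x g x)%E.
Proof.
move=> mg g0.
rewrite -(@ge0_integral_distribution _ _ _ _ _ P X' g mg g0).
by apply: eq_measure_integral => A mA _; exact: gX.
Qed.

Lemma has_mean_gaussian_comp_norm (u : R -> R) (m : R) :
  measurable_fun setT u -> (forall x, 0 <= x -> 0 <= u x) ->
  half_normal_tail u 0 = m%:E -> has_mean P (fun w => u `|X w|) m.
Proof.
move=> mu u0 um.
have mua : measurable_fun setT (fun x : R => u `|x|).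
  by apply: measurableT_comp => //; exact: normr_measurable.
apply: ge0_has_mean => [|w|].
- exact: (measurableT_comp mua).
- exact: u0.
- rewrite (@ge0_integral_gaussian (fun x => (u `|x|)%:E)).
  + by rewrite ge0_integral_normal_prob_comp_norm.
  + exact/measurable_EFinP.
  + by move=> x; rewrite lee_fin u0.
Qed.

Lemma has_mean_gaussian_norm : has_mean P (fun w => `|X w|) (Num.sqrt (2 / pi)).
Proof.
apply: (@has_mean_gaussian_comp_norm id); [exact: measurable_id|by []|].
exact: half_normal_tail_id0.
Qed.

Lemma has_mean_gaussian_sqr : has_mean P (fun w => X w ^+ 2) 1.
Proof.
have := @has_mean_gaussian_comp_norm (fun x => x ^+ 2) 1 (exprn_measurable _)
  (fun x _ => sqr_ge0 x) (@half_normal_tail_sqr0 R).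
by under eq_fun do rewrite real_normK ?num_real//.
Qed.

Lemma Lfun2_gaussian_norm : (fun w => `|X w|) \in Lfun P 2%:E.
Proof.
apply: (@has_mean_Lfun2 _ _ _ _ _ 1).
  by apply: measurableT_comp => //; exact: normr_measurable.
by under eq_fun do rewrite real_normK ?num_real//; exact: has_mean_gaussian_sqr.
Qed.

End gaussian_law.

Section gaussian_pair_law.
Variables X Y : {RV P >-> R}.
Hypotheses (gX : standard_gaussian X) (gY : standard_gaussian Y).
Hypothesis XY : independent_pair X Y.

Let pairXY (w : T) : measurableTypeR R * measurableTypeR R := (X w, Y w).
Let mpairXY : measurable_fun setT pairXY.
Proof.
have mX : measurable_fun setT X by [].
have mY : measurable_fun setT Y by [].
by apply/measurable_fun_pair => mT A mA; [exact: mX|exact: mY].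
Qed.

HB.instance Definition _ := isMeasurableFun.Build _ _ _ _ pairXY mpairXY.

(** Independence says that the joint law and the product law agree on
    rectangles, which determines a product measure. *)
Lemma ge0_integral_gaussian_pair (G : R * R -> \bar R) :
  measurable_fun setT G -> (forall z, 0 <= G z)%E ->
  (\int[P]_w G (X w, Y w) = \int[N2]_z G z)%E.
Proof.
move=> mG G0.
rewrite -(@ge0_integral_distribution _ _ _ _ _ P pairXY G mG G0).
apply: eq_measure_integral => A mA _; apply/esym.
apply: (@product_measure_unique _ _ _ _ _ N01 N01 (distribution P pairXY)) => //.
move=> B C mB mC.
transitivity (P (X @^-1` B) * P (Y @^-1` C))%E; first exact: XY.
by congr (_ * _)%E; [exact: gX|exact: gY].
Qed.

Lemma has_mean_gaussian_pair (G : R * R -> R) (m : R) :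
  measurable_fun setT G -> (forall z, 0 <= G z) ->
  (\int[N2]_z (G z)%:E = m%:E)%E -> has_mean P (fun w => G (X w, Y w)) m.
Proof.
move=> mG G0 Gm; apply: ge0_has_mean => //.
  exact: (measurableT_comp mG).
by rewrite (@ge0_integral_gaussian_pair (EFin \o G))//; exact/measurable_EFinP.
Qed.

(** The pair (X, - Y) has the law of (X, Y), so both terms of the sum have the
    same mean.  As G is nonnegative, the finiteness of the mean of G (X, Y) is
    part of the conclusion. *)
Lemma has_mean_gaussian_reflect (G : R * R -> R) (m : R) :
  measurable_fun setT G -> (forall z, 0 <= G z) ->
  has_mean P (fun w => G (X w, Y w) + G (X w, - Y w)) (2 * m) ->
  has_mean P (fun w => G (X w, Y w)) m.
Proof.
move=> mG G0.
pose Gr (z : R * R) := G (z.1, - z.2).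
have mGr : measurable_fun setT Gr.
  apply: (measurableT_comp mG); apply/measurable_fun_pair => //.
  exact: measurable_funN.
have Gr0 z : 0 <= Gr z by exact: G0.
have GrE : (\int[N2]_z (Gr z)%:E = \int[N2]_z (G z)%:E)%E.
  rewrite !ge0_integral_normal2_xy//.
  apply: eq_integral => x _; rewrite /Gr /=.
  apply: (@ge0_integral_normal_probN _ (fun y => (G (x, y))%:E)).
    by apply/measurable_EFinP; exact: measurable_fun_pair2.
  by move=> y; rewrite lee_fin.
move=> GD; have := has_mean_ge0 GD.
rewrite (@ge0_integral_gaussian_pair (fun z => (G z + Gr z)%:E)); last 2 first.
- by apply/measurable_EFinP/measurable_funD.
- by move=> z; rewrite lee_fin addr_ge0.
under eq_integral do rewrite EFinD.
rewrite ge0_integralD//; last 4 first.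
- by move=> z _; rewrite lee_fin.
- by apply/measurable_EFinP; exact: mG.
- by move=> z _; rewrite lee_fin.
- by apply/measurable_EFinP; exact: mGr.
rewrite GrE => h; apply: has_mean_gaussian_pair => //.
move: h; set I := integral _ _ _; case: I => [r [h]||]//.
by congr EFin; lra.
Qed.

End gaussian_pair_law.

End pair_law.

(** * Moments of two independent Gaussian variables and of their sum *)

Section limit_moments.
Context d (T : measurableType d) (R : realType) (P : probability T R).
Variables X Y : {RV P >-> R}.
Hypotheses (gX : standard_gaussian X) (gY : standard_gaussian Y).
Hypothesis XY : independent_pair X Y.

Let mfst : measurable_fun setT (fst : R * R -> R).
Proof. exact: measurable_fst. Qed.
Let msnd : measurable_fun setT (snd : R * R -> R).
Proof. exact: measurable_snd. Qed.
Let mnorm (g : R * R -> R) : measurable_fun setT g ->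
  measurable_fun setT (fun z => `|g z|).
Proof. by move=> mg; apply: measurableT_comp => //; exact: normr_measurable. Qed.

Lemma has_mean_prod (u v : R -> R) (m n : R) :
  measurable_fun setT u -> measurable_fun setT v ->
  (forall x, 0 <= x -> 0 <= u x) -> (forall x, 0 <= x -> 0 <= v x) ->
  half_normal_tail u 0 = m%:E -> half_normal_tail v 0 = n%:E ->
  has_mean P (fun w => u `|X w| * v `|Y w|) (m * n).
Proof.
move=> mu mv u0 v0 um vn.
apply: (has_mean_gaussian_pair gX gY XY (G := fun z => u `|z.1| * v `|z.2|)).
- apply: measurable_funM.
    by apply: (measurableT_comp mu); exact: mnorm.
  by apply: (measurableT_comp mv); exact: mnorm.
- by move=> z; rewrite mulr_ge0 ?u0 ?v0.
- by rewrite ge0_integral_normal2_prod// um vn.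
Qed.

Let mid : measurable_fun setT (@id R).
Proof. exact: measurable_id. Qed.
Let msqr : measurable_fun setT (fun x : R => x ^+ 2).
Proof. exact: exprn_measurable. Qed.
Let id0 (x : R) : 0 <= x -> 0 <= id x. Proof. by []. Qed.
Let sqr0 (x : R) : 0 <= x -> 0 <= x ^+ 2. Proof. by rewrite sqr_ge0. Qed.

Let E1 := @half_normal_tail_id0 R.
Let E2 := @half_normal_tail_sqr0 R.

Lemma has_mean_normXY : has_mean P (fun w => `|X w| * `|Y w|) (2 / pi).
Proof.
apply: has_mean_eq (has_mean_prod mid mid id0 id0 E1 E1) _ _ => [w//|].
by rewrite -expr2 sqr_sqrtr// divr_ge0 ?pi_ge0.
Qed.

Lemma has_mean_sqrXY : has_mean P (fun w => (X w * Y w) ^+ 2) 1.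
Proof.
apply: has_mean_eq (has_mean_prod msqr msqr sqr0 sqr0 E2 E2) _ _ => [w|].
  by rewrite !real_normK ?num_real// exprMn.
by rewrite mulr1.
Qed.

Lemma has_mean_sqrX_normY :
  has_mean P (fun w => `|X w| ^+ 2 * `|Y w|) (Num.sqrt (2 / pi)).
Proof.
apply: has_mean_eq (has_mean_prod msqr mid sqr0 id0 E2 E1) _ _ => [w//|].
by rewrite mul1r.
Qed.

Lemma has_mean_normX_sqrY :
  has_mean P (fun w => `|X w| * `|Y w| ^+ 2) (Num.sqrt (2 / pi)).
Proof.
apply: has_mean_eq (has_mean_prod mid msqr id0 sqr0 E1 E2) _ _ => [w//|].
by rewrite mulr1.
Qed.

Let mmax : measurable_fun setT (fun z : R * R => Num.max `|z.1| `|z.2|).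
Proof. by apply: measurable_maxr; exact: mnorm. Qed.
Let mmin : measurable_fun setT (fun z : R * R => Num.min `|z.1| `|z.2|).
Proof. by apply: measurable_minr; exact: mnorm. Qed.

Lemma has_mean_max :
  has_mean P (fun w => Num.max `|X w| `|Y w|) (2 / Num.sqrt pi).
Proof.
apply: (has_mean_gaussian_pair gX gY XY (G := fun z => Num.max `|z.1| `|z.2|)) => //.
exact: integral_normal2_max.
Qed.

Lemma has_mean_sqr_max :
  has_mean P (fun w => (Num.max `|X w| `|Y w|) ^+ 2) (1 + 2 / pi).
Proof.
apply: (has_mean_gaussian_pair gX gY XY (G := fun z => (Num.max `|z.1| `|z.2|) ^+ 2)).
- exact: measurable_funX.
- by move=> z; rewrite sqr_ge0.
- exact: integral_normal2_sqr_max.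
Qed.

Lemma has_mean_max_sqr_min :
  has_mean P (fun w => Num.max `|X w| `|Y w| * (Num.min `|X w| `|Y w|) ^+ 2)
    (1 / Num.sqrt pi).
Proof.
apply: (has_mean_gaussian_pair gX gY XY
  (G := fun z => Num.max `|z.1| `|z.2| * (Num.min `|z.1| `|z.2|) ^+ 2)).
- by apply: measurable_funM => //; exact: measurable_funX.
- by move=> z; rewrite mulr_ge0 ?sqr_ge0// le_max normr_ge0.
- exact: integral_normal2_max_sqr_min.
Qed.

Lemma normD_normB_max (x y : R) : `|x + y| + `|x - y| = 2 * Num.max `|x| `|y|.
Proof.
by case: (ger0P x) => ?; case: (ger0P y) => ?; case: (ger0P (x + y)) => ?;
  case: (ger0P (x - y)) => ?; case: leP => ?; lra.
Qed.

Let mD : measurable_fun setT (fun z : R * R => `|z.1 + z.2|).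
Proof. by apply: mnorm; exact: measurable_funD. Qed.

Lemma has_mean_normD : has_mean P (fun w => `|X w + Y w|) (2 / Num.sqrt pi).
Proof.
apply: (has_mean_gaussian_reflect gX gY XY (G := fun z => `|z.1 + z.2|)) => //.
apply: has_mean_eq (has_meanZ 2 has_mean_max) _ _ => // w /=.
by rewrite normD_normB_max.
Qed.

Lemma has_mean_normD_sqr :
  has_mean P (fun w => `|X w + Y w| ^+ 2) 2.
Proof.
apply: (has_mean_gaussian_reflect gX gY XY (G := fun z => `|z.1 + z.2| ^+ 2)).
- exact: measurable_funX.
- by move=> z; rewrite sqr_ge0.
- apply: has_mean_eq (has_meanZ 2 (has_meanD
    (has_mean_gaussian_sqr gX) (has_mean_gaussian_sqr gY))) _ _ => [w|]//=.
  by rewrite !real_normK ?num_real//; ring.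
Qed.

(** With B = |X| and C = |Y|, reflection turns |X + Y| (B + C) into
    max (B, C) (B + C), which equals max (B, C)^2 + B C. *)
Lemma has_mean_normD_sum :
  has_mean P (fun w => `|X w + Y w| * (`|X w| + `|Y w|)) (1 + 4 / pi).
Proof.
apply: (has_mean_gaussian_reflect gX gY XY
  (G := fun z => `|z.1 + z.2| * (`|z.1| + `|z.2|))).
- by apply: measurable_funM => //; apply: measurable_funD; exact: mnorm.
- by move=> z; rewrite mulr_ge0 ?addr_ge0.
- apply: has_mean_eq (has_meanZ 2 (has_meanD has_mean_sqr_max has_mean_normXY))
    _ _ => [w|]/=.
    rewrite normrN -mulrDl normD_normB_max.
    by case: leP => _; ring.
  by move: (pi^-1 : R) => q; ring.
Qed.

(** With B = |X| and C = |Y|, reflection turns |X + Y| B C into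
    max (B, C) B C, and B C (B + C) is the sum of max (B, C) B C and
    max (B, C) min (B, C)^2. *)
Lemma has_mean_normD_normXY :
  has_mean P (fun w => `|X w + Y w| * (`|X w| * `|Y w|))
    (2 * Num.sqrt (2 / pi) - 1 / Num.sqrt pi).
Proof.
apply: (has_mean_gaussian_reflect gX gY XY
  (G := fun z => `|z.1 + z.2| * (`|z.1| * `|z.2|))).
- by apply: measurable_funM => //; apply: measurable_funM; exact: mnorm.
- by move=> z; rewrite !mulr_ge0.
- apply: has_mean_eq (has_meanZ 2 (has_meanB
    (has_meanD has_mean_sqrX_normY has_mean_normX_sqrY) has_mean_max_sqr_min))
    _ _ => [w|]/=.
    rewrite normrN -mulrDl normD_normB_max.
    by case: leP => _; ring.
  by ring.
Qed.

End limit_moments.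

(** * The two limit variables *)

Section limit_variance.
Context d (T : measurableType d) (R : realType) (P : probability T R).

Variables X Y : {RV P >-> R}.
Hypotheses (gX : standard_gaussian X) (gY : standard_gaussian Y).
Hypothesis XY : independent_pair X Y.

Lemma Lfun2_gaussian_normM : (fun w => `|X w| * `|Y w|) \in Lfun P 2%:E.
Proof.
apply: (@has_mean_Lfun2 _ _ _ _ _ 1).
  by apply: measurable_funM; apply: measurableT_comp => //; exact: normr_measurable.
apply: has_mean_eq (has_mean_sqrXY gX gY XY) _ _ => // w.
by rewrite !exprMn !real_normK ?num_real.
Qed.

Definition skew_limit (a : R) (w : T) : R :=
  a * (`|X w + Y w| - `|X w| - `|Y w|) + a ^+ 2 * `|X w| * `|Y w|.

Lemma measurable_skew_limit a : measurable_fun setT (skew_limit a).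
Proof.
have mX : measurable_fun setT (fun w => `|X w|).
  by apply: measurableT_comp => //; exact: normr_measurable.
have mY : measurable_fun setT (fun w => `|Y w|).
  by apply: measurableT_comp => //; exact: normr_measurable.
have mXY : measurable_fun setT (fun w => `|X w + Y w|).
  by apply: measurableT_comp; [exact: normr_measurable|exact: measurable_funD].
apply: measurable_funD; last first.
  by apply: measurable_funM => //; exact: measurable_funM.
apply: measurable_funM => //; apply: measurable_funB => //.
exact: measurable_funB.
Qed.

Lemma has_mean_skew_limit (a : R) : has_mean P (skew_limit a)
  (a * (2 / Num.sqrt pi - Num.sqrt (2 / pi) - Num.sqrt (2 / pi)) + a ^+ 2 * (2 / pi)).
Proof.
apply: has_mean_eq (has_meanD (has_meanZ a (has_meanB (has_meanB
  (has_mean_normD gX gY XY) (has_mean_gaussian_norm gX)) (has_mean_gaussian_norm gY)))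
  (has_meanZ (a ^+ 2) (has_mean_normXY gX gY XY))) _ _ => // w.
by rewrite /skew_limit mulrA.
Qed.

(** Expand the square, with A = |X + Y|, B = |X| and C = |Y|.  The coefficient
    of a^2 is the mean of A^2 + B^2 + C^2 + 2 B C - 2 A (B + C), that of 2 a^3
    is the mean of A B C - B^2 C - B C^2, and that of a^4 is the mean of
    B^2 C^2. *)
Lemma has_mean_sqr_skew_limit (a : R) : has_mean P (fun w => skew_limit a w ^+ 2)
  (a ^+ 2 * (2 - 4 / pi) - 2 * a ^+ 3 / Num.sqrt pi + a ^+ 4).
Proof.
have H2 := has_meanB (has_meanD (has_meanD (has_meanD
    (has_mean_normD_sqr gX gY XY)
    (has_mean_gaussian_sqr gX)) (has_mean_gaussian_sqr gY))
    (has_meanZ 2 (has_mean_normXY gX gY XY)))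
    (has_meanZ 2 (has_mean_normD_sum gX gY XY)).
have H3 := has_meanB (has_meanB (has_mean_normD_normXY gX gY XY)
    (has_mean_sqrX_normY gX gY XY)) (has_mean_normX_sqrY gX gY XY).
apply: has_mean_eq (has_meanD (has_meanD (has_meanZ (a ^+ 2) H2)
  (has_meanZ (2 * a ^+ 3) H3)) (has_meanZ (a ^+ 4) (has_mean_sqrXY gX gY XY))) _ _.
- move=> w; rewrite /skew_limit exprMn.
  rewrite -(real_normK (num_real (X w))) -(real_normK (num_real (Y w))).
  by ring.
- by move: (Num.sqrt (2 / pi : R)) (pi^-1 : R) ((Num.sqrt (pi : R))^-1) => s q r; ring.
Qed.

Lemma variance_skew_limit (a : R) : 'V_P[skew_limit a]%E =
  ((2 - 16 / pi + 8 * Num.sqrt 2 / pi) * a ^+ 2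
   + 2 * ((- 4 - pi + 4 * Num.sqrt 2) / pi `^ (3 / 2)) * a ^+ 3
   + (1 - 4 / pi ^+ 2) * a ^+ 4)%:E.
Proof.
rewrite (has_mean_variance (measurable_skew_limit a) (has_mean_skew_limit a)
  (has_mean_sqr_skew_limit a)); congr EFin.
have p0 := pi_gt0 R.
have -> : (pi : R) `^ (3 / 2) = Num.sqrt pi ^+ 3.
  rewrite (_ : 3 / 2 = 2^-1 * 3%:R :> R); last by rewrite mulrC.
  by rewrite powRrM powR12_sqrt ?powR_mulrn ?sqrtr_ge0// ltW.
rewrite sqrtrM// sqrtrV ?(ltW p0)//.
(* Everything becomes a rational function of sqrt pi and sqrt 2. *)
have piE : (pi : R) = Num.sqrt pi ^+ 2 by rewrite sqr_sqrtr ?ltW.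
rewrite [in X in _ = X]piE [in X in X = _]piE.
have r0 : Num.sqrt pi > 0 :> R by rewrite sqrtr_gt0.
have q2 : Num.sqrt 2 ^+ 2 = 2 :> R by rewrite sqr_sqrtr.
have rr : Num.sqrt (Num.sqrt (pi : R) ^+ 2) = Num.sqrt pi.
  by rewrite sqrtr_sqr gtr0_norm.
rewrite rr; clear p0 piE rr.
move: (Num.sqrt (pi : R)) (Num.sqrt (2 : R)) r0 q2 => r q r0 q2.
apply/eqP; rewrite -subr_eq0; apply/eqP.
(* The two sides differ by a multiple of q^2 - 2, with q = sqrt 2. *)
transitivity (- 4 * (q ^+ 2 - 2) * a ^+ 2 / r ^+ 2); last first.
  by rewrite q2 subrr mulr0 !mul0r.
by field; rewrite gt_eqF.
Qed.

Lemma skew_limit_Lfun2 (a : R) : skew_limit a \in Lfun P 2%:E.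
Proof. exact: has_mean_Lfun2 (measurable_skew_limit a) (has_mean_sqr_skew_limit a). Qed.

Lemma Lfun2_gaussianM : (fun w => X w * Y w) \in Lfun P 2%:E.
Proof.
by apply: has_mean_Lfun2 (has_mean_sqrXY gX gY XY); exact: measurable_funM.
Qed.

End limit_variance.

Section gaussian_limits.
Context d (T : measurableType d) (R : realType) (P : probability T R).

Lemma Lfun2D (f g : T -> R) : f \in Lfun P 2%:E -> g \in Lfun P 2%:E ->
  (fun w => f w + g w) \in Lfun P 2%:E.
Proof. by move=> f2 g2; rewrite (_ : (fun _ => _) = f + g)// rpredD// lee1n. Qed.

Lemma Lfun2Z (k : R) (f : T -> R) : f \in Lfun P 2%:E ->
  (fun w => k * f w) \in Lfun P 2%:E.
Proof.
move=> f2; rewrite (_ : (fun _ => _) = k \o* f).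
  by apply: Lfun_scale; rewrite ?ler1n.
by apply/funext => w /=; rewrite mulrC.
Qed.

Section product_limit.
Variables X Y : {RV P >-> R}.
Hypotheses (gX : standard_gaussian X) (gY : standard_gaussian Y).
Hypothesis XY : independent_pair X Y.

(** X Y is half of (X + Y)^2 - X^2 - Y^2. *)
Lemma has_mean_gaussianM : has_mean P (fun w => X w * Y w) 0.
Proof.
apply: has_mean_eq (has_meanZ 2^-1 (has_meanB (has_meanB
  (has_mean_normD_sqr gX gY XY) (has_mean_gaussian_sqr gX))
  (has_mean_gaussian_sqr gY))) _ _ => [w|]; last by field.
by rewrite real_normK ?num_real//; field.
Qed.

Lemma product_limit_Lfun2 (k : R) : (fun w => k * X w * Y w) \in Lfun P 2%:E.
Proof.
under eq_fun do rewrite -mulrA.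
by apply: Lfun2Z; exact: Lfun2_gaussianM gX gY XY.
Qed.

Lemma variance_product_limit (k : R) :
  'V_P[(fun w => k * X w * Y w)%R]%E = (k ^+ 2)%:E.
Proof.
have -> : (fun w => k * X w * Y w) = (fun w => k * (X w * Y w)).
  by apply/funext => w; rewrite mulrA.
rewrite (has_mean_variance (m := k * 0) (v := k ^+ 2 * 1)).
- by rewrite mulr0 mulr1 expr0n subr0.
- by apply: measurable_funM => //; exact: measurable_funM.
- exact: has_meanZ has_mean_gaussianM.
- apply: has_mean_eq (has_meanZ (k ^+ 2) (has_mean_sqrXY gX gY XY)) _ _ => // w.
  by rewrite [RHS]exprMn.
Qed.

End product_limit.

End gaussian_limits.

(** * Convergence at rate 1/x *)

Section rate.
Context d (T : measurableType d) (R : realType) (P : probability T R).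

Lemma has_mean_Lfun1 (Z : T -> R) : Z \in Lfun P 1 ->
  has_mean P Z (fine 'E_P[Z]%E).
Proof. by move=> Z1; split => //; rewrite fineK// expectation_fin_num. Qed.

Lemma has_mean_le (Y Z : T -> R) (m n : R) : has_mean P Y m -> has_mean P Z n ->
  (forall w, Y w <= Z w) -> m <= n.
Proof.
move=> [/Lfun1_integrable Y1 mY] [/Lfun1_integrable Z1 mZ] YZ.
rewrite -lee_fin -mY -mZ unlock; apply: le_integral => // w _.
by rewrite lee_fin.
Qed.

(** The bound on the norms gives the convergence in L^2 of dominated
    errors. *)
Lemma Lfun2_dominated (Y W : T -> R) : measurable_fun setT Y ->
  W \in Lfun P 2%:E -> (forall w, `|Y w| <= W w) ->
  Y \in Lfun P 2%:E /\ ('N[P]_2%:E[EFin \o Y] <= 'N[P]_2%:E[EFin \o W])%E.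
Proof.
move=> mY W2 YW.
have mW : measurable_fun setT W by move: W2; rewrite inE => /andP[]; rewrite inE.
have mp (V : T -> R) : measurable_fun setT V ->
    measurable_fun setT (fun w => (`|V w| `^ 2)%:E).
  move=> mV; apply/measurable_EFinP.
  apply: (measurableT_comp (measurable_powR (2 : R))).
  by apply: measurableT_comp => //; exact: normr_measurable.
have NYW : ('N[P]_2%:E[EFin \o Y] <= 'N[P]_2%:E[EFin \o W])%E.
  rewrite unlock /Lnorm; apply: gt0_ler_poweR.
  - by [].
  - by rewrite in_itv/= leey integral_ge0.
  - by rewrite in_itv/= leey integral_ge0.
  apply: ge0_le_integral => //.
  - by move=> w _; rewrite poweR_ge0.
  - exact: mp mY.
  - exact: mp mW.
  - move=> w _; rewrite /= lee_fin ge0_ler_powR ?nnegrE//.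
    by rewrite (le_trans (YW w)) ?ler_norm.
split => //; rewrite inE; apply/andP; split; rewrite inE//=.
apply: le_lt_trans NYW _.
by move: W2; rewrite inE => /andP[_]; rewrite inE.
Qed.

Variables (D : R -> T -> R) (Z W : T -> R).
Hypothesis mD : forall x, measurable_fun setT (D x).
Hypothesis Z2 : Z \in Lfun P 2%:E.
Hypothesis W2 : W \in Lfun P 2%:E.
Hypothesis rateD : forall x w, 0 < x -> `|D x w / x - Z w| <= W w / x.

Let mZ : measurable_fun setT Z.
Proof. by move: Z2; rewrite inE => /andP[]; rewrite inE. Qed.

Let dominated_error x : 0 < x ->
  (fun w => D x w / x - Z w) \in Lfun P 2%:E /\
  ('N[P]_2%:E[EFin \o (fun w => D x w / x - Z w)%R] <=
   (x^-1)%:E * 'N[P]_2%:E[EFin \o W])%E.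
Proof.
move=> x0.
have W2x : (fun w => W w / x) \in Lfun P 2%:E by apply: Lfun_scale; rewrite ?ler1n.
have [|E2 NE] := @Lfun2_dominated (fun w => D x w / x - Z w) _ _ W2x
    (fun w => rateD w x0).
  by apply: measurable_funB => //; exact: measurable_funM.
split => //; apply: (le_trans NE).
have := LnormZ (Lfun_Sub (lee1n 2) W2) x^-1.
rewrite gtr0_norm ?invr_gt0// => <-.
rewrite le_eqVlt; apply/orP; left; apply/eqP.
by apply: eq_Lnorm => w /=; rewrite mulrC.
Qed.

Let Lfun2_quotient x : 0 < x -> (fun w => D x w / x) \in Lfun P 2%:E.
Proof.
move=> x0; have [E2 _] := dominated_error x0.
have -> : (fun w => D x w / x) = (fun w => D x w / x - Z w) + Z.
  by apply/funext => w; rewrite fctE subrK.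
by rewrite rpredD// lee1n.
Qed.

Lemma rate_cvg_in_Lp2 : cvg_in_Lp P 2%:E (+oo : set_system R)
  (fun x w => D x w / x) Z.
Proof.
split => //.
  by near=> x; apply: Lfun2_quotient; near: x; exact: nbhs_pinfty_gt.
have W2fin : ('N[P]_2%:E[EFin \o W] \is a fin_num)%E.
  rewrite ge0_fin_numE; last exact: Lnorm_ge0.
  by move: W2; rewrite inE => /andP[_]; rewrite inE.
apply: (@squeeze_cvge _ _ _ R (cst 0%E)
    (fun x => 'N[P]_2%:E[EFin \o (fun w => D x w / x - Z w)%R]%E)
    (fun x => (x^-1)%:E * 'N[P]_2%:E[EFin \o W])%E).
- near=> x; rewrite Lnorm_ge0/=.
  have x0 : 0 < x by near: x; exact: nbhs_pinfty_gt.
  by have [_] := dominated_error x0.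
- exact: cvg_cst.
- rewrite -(fineK W2fin); under eq_fun do rewrite -EFinM.
  apply: cvg_EFin; first by near=> x.
  rewrite -(mul0r (fine ('N[P]_2%:E[EFin \o W])%E)).
  apply: cvgM; last exact: cvg_cst.
  rewrite gtr0_cvgV0; first exact: cvg_id.
  by near=> x; near: x; exact: nbhs_pinfty_gt.
Unshelve. all: by end_near. Qed.

(** The means differ by at most the mean of V divided by x. *)
Lemma rate_cvg_mean (G : R -> T -> R) (L V : T -> R) :
  (forall x, 0 < x -> G x \in Lfun P 1) -> L \in Lfun P 1 -> V \in Lfun P 1 ->
  (forall x w, 1 <= x -> `|G x w - L w| <= V w / x) ->
  fine 'E_P[G x]%E @[x --> +oo] --> fine 'E_P[L]%E.
Proof.
move=> G1 L1 V1 GLV.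
have mL := has_mean_Lfun1 L1; have mV := has_mean_Lfun1 V1.
apply/cvgrPdist_le => /= e e0; near=> x.
have x1 : 1 <= x by near: x; exact: nbhs_pinfty_ge.
have x0 : 0 < x by exact: lt_le_trans x1.
have mG := has_mean_Lfun1 (G1 _ x0).
apply: (@le_trans _ _ (x^-1 * fine 'E_P[V]%E)).
  rewrite ler_norml; apply/andP; split.
    rewrite -mulN1r mulrA.
    apply: has_mean_le (has_meanZ _ mV) (has_meanB mL mG) _ => w.
    have := GLV x w x1; rewrite distrC ler_norml mulrC => /andP[+ _].
    by rewrite mulN1r mulNr.
  apply: has_mean_le (has_meanB mL mG) (has_meanZ _ mV) _ => w.
  by have := GLV x w x1; rewrite distrC ler_norml mulrC => /andP[_].
rewrite ler_pdivrMl//.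
apply: (@le_trans _ _ `|fine 'E_P[V]%E|); first exact: ler_norm.
by rewrite -ler_pdivrMr//; near: x; exact: nbhs_pinfty_ge.
Unshelve. all: by end_near. Qed.

(** The variance of D x / x is the mean of its square minus the square of its
    mean, and both converge by the preceding lemma.  For the square, use
    F^2 - Z^2 = (F - Z) (2 Z + (F - Z)) with |F - Z| <= W / x <= W for
    x >= 1. *)
Lemma rate_cvg_variance (v : R) : 'V_P[Z]%E = v%:E ->
  ((1 / x ^+ 2)%:E * 'V_P[D x])%E @[x --> (+oo : set_system R)] --> v%:E.
Proof.
have Pfin : P setT \is a fin_num by exact: fin_num_measure.
have L21 := @Lfun_subset12 _ _ _ P Pfin.
pose F x w := D x w / x.
have F2 x : 0 < x -> F x \in Lfun P 2%:E by exact: Lfun2_quotient.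
have sqr1 (Y : T -> R) : Y \in Lfun P 2%:E -> (fun w => Y w ^+ 2) \in Lfun P 1.
  by move=> Y2; apply/Lfun1_integrable; exact: Lfun2_integrable_sqr.
have cF : fine 'E_P[F x]%E @[x --> +oo] --> fine 'E_P[Z]%E.
  apply: (@rate_cvg_mean F Z W).
  - by move=> x x0; apply: L21; exact: F2.
  - exact: L21.
  - exact: L21.
  - by move=> x w x1; apply: rateD; exact: lt_le_trans x1.
have nZ2 : (fun w => `|Z w|) \in Lfun P 2%:E.
  apply: sqr_Lfun2.
    by apply: measurableT_comp => //; exact: normr_measurable.
  under eq_fun do rewrite real_normK ?num_real//.
  exact: sqr1.
have cF2 : fine 'E_P[fun w => (F x w ^+ 2)%R]%E @[x --> +oo] -->
    fine 'E_P[fun w => (Z w ^+ 2)%R]%E.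
  apply: (@rate_cvg_mean (fun x w => F x w ^+ 2) (fun w => Z w ^+ 2)
    (fun w => W w * (2 * `|Z w| + W w))).
  - by move=> x x0; apply: sqr1; exact: F2.
  - exact: sqr1.
  - apply: Lfun2_mul_Lfun1 => //.
    have -> : (fun w => 2 * `|Z w| + W w) = 2 \o* (fun w => `|Z w|) + W.
      by apply/funext => w; rewrite fctE /= mulrC.
    rewrite rpredD ?lee1n// => p1.
    by apply: Lfun_scale => //; rewrite ler1n.
  - move=> x w x1; have x0 : 0 < x by exact: lt_le_trans x1.
    have h := rateD w x0; rewrite -/(F x w) in h.
    rewrite subr_sqr normrM mulrAC ler_pM//.
    rewrite (_ : F x w + Z w = 2 * Z w + (F x w - Z w)); last by ring.
    apply: (le_trans (ler_normD _ _)); rewrite normrM ger0_norm// lerD2l.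
    apply: (le_trans h); rewrite ler_pdivrMr// ler_peMr//.
    by have := le_trans (normr_ge0 _) h; rewrite pmulr_lge0 ?invr_gt0.
move=> vE.
have -> : v = fine 'E_P[fun w => (Z w ^+ 2)%R]%E - (fine 'E_P[Z]%E) ^+ 2.
  have := has_mean_variance mZ (has_mean_Lfun1 (L21 _ Z2)) (has_mean_Lfun1 (sqr1 _ Z2)).
  by rewrite vE => -[].
have eqV : \forall x \near +oo,
    (fine 'E_P[fun w => (F x w ^+ 2)%R]%E - (fine 'E_P[F x]%E) ^+ 2)%:E =
    ((1 / x ^+ 2)%:E * 'V_P[D x])%E.
  near=> x.
  have x0 : 0 < x by near: x; exact: nbhs_pinfty_gt.
  have mF : measurable_fun setT (F x) by exact: measurable_funM.
  rewrite -(has_mean_variance mF (has_mean_Lfun1 (L21 _ (F2 _ x0)))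
     (has_mean_Lfun1 (sqr1 _ (F2 _ x0)))).
  rewrite -[F x]/(x^-1 \o* D x) varianceZ ?exprVn ?div1r//.
  have -> : D x = x \o* F x by apply/funext => w; rewrite /= divfK// gt_eqF.
  by apply: Lfun_scale; [rewrite ler1n|exact: F2].
apply: cvg_trans (near_eq_cvg eqV) _.
apply: cvg_EFin; first by near=> x.
by apply: cvgB => //; exact: (cvgM cF cF).
Unshelve. all: by end_near. Qed.

End rate.

(** * Pathwise bounds for one step of the two schemes *)

Section tamed_bounds.
Context {R : realType}.
Variables (beta gamma : R).

Definition taming (eta y : R) : R :=
  eta * drift beta y / (1 + eta * `|drift beta y|).

Lemma normr_taming_le1 eta y : 0 <= eta -> `|taming eta y| <= 1.
Proof.
move=> eta0; rewrite /taming.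
have d0 : 0 <= eta * `|drift beta y| by rewrite mulr_ge0.
rewrite normrM normfV normrM (ger0_norm eta0) (@ger0_norm _ (1 + _)) ?addr_ge0//.
by rewrite ler_pdivrMr ?mul1r ?lerDr// ltr_wpDr.
Qed.

(** The noise scale of the coarse step is sqrt 2 times that of a fine step, and
    this factor cancels the normalization of the coarse noise. *)
Lemma noise_scale_sqrt2 h : 0 <= h ->
  gamma * Num.sqrt h = noise_scale gamma h * Num.sqrt 2.
Proof.
by move=> h0; rewrite /noise_scale -mulrA -sqrtrM ?divr_ge0// divfK.
Qed.

(** Up to the tamed drift increments, which are bounded by 1, the difference is
    a^2 x G1 G2.  The increment of the first fine step is multiplied by
    1 + a G2 in the second one, hence the term a |G2|. *)
Lemma tamed_rate (T : Type) (G1 G2 : T -> R) h x w : 0 < h -> 0 < gamma -> 0 < x ->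
  `|tamed_diff beta gamma h G1 G2 x w / x
    - noise_scale gamma h ^+ 2 * G1 w * G2 w| <=
  (3 + noise_scale gamma h * `|G2 w|) / x.
Proof.
move=> h0 g0 x0; set a := noise_scale gamma h.
have a0 : 0 <= a by rewrite mulr_ge0 ?sqrtr_ge0 ?ltW.
set y := tamed_step beta gamma (h / 2) x (G1 w).
have q0 : Num.sqrt 2 != 0 :> R by rewrite gt_eqF// sqrtr_gt0.
have -> : tamed_diff beta gamma h G1 G2 x w / x - a ^+ 2 * G1 w * G2 w =
    (taming (h / 2) x + taming (h / 2) y + a * taming (h / 2) x * G2 w
     - taming h x) / x.
  have yE : y = x + taming (h / 2) x + a * x * G1 w.
    by rewrite /y /tamed_step -/(taming _ _) /a /noise_scale; ring.
  have -> : tamed_diff beta gamma h G1 G2 x w =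
      y + taming (h / 2) y + a * y * G2 w
      - (x + taming h x + a * x * (G1 w + G2 w)).
    rewrite /tamed_diff /tamed_fine /tamed_coarse -/y /coarse_noise.
    rewrite {1 2}/tamed_step -!/(taming _ _); congr (_ + _ - (_ + _)).
      by rewrite /a /noise_scale; ring.
    rewrite (_ : gamma * x * Num.sqrt h = (gamma * Num.sqrt h) * x); last by ring.
    by rewrite noise_scale_sqrt2 ?ltW// -/a; field.
  by rewrite yE; field; rewrite gt_eqF.
rewrite normrM normfV (gtr0_norm x0) ler_pM2r ?invr_gt0//.
have t1 := normr_taming_le1 x (ltW (divr_gt0 h0 (ltr0n _ 2))).
have t2 := normr_taming_le1 y (ltW (divr_gt0 h0 (ltr0n _ 2))).
have t3 := normr_taming_le1 x (ltW h0).
apply: (le_trans (ler_normB _ _)).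
have -> : 3 + a * `|G2 w| = (1 + 1 + a * `|G2 w|) + 1 by ring.
apply: lerD => //; apply: (le_trans (ler_normD _ _)); apply: lerD.
  by apply: (le_trans (ler_normD _ _)); exact: lerD.
rewrite (normrM _ (G2 w)) (normrM a) (ger0_norm a0) -mulrA ler_wpM2l//.
by rewrite ler_piMl.
Qed.

End tamed_bounds.

Section skew_bounds.
Context {R : realType}.
Variables (beta gamma : R).
Hypotheses (beta0 : 0 < beta) (gamma0 : 0 < gamma).

(** The part of the noise of a skew step that disappears far from the origin:
    the noise is - |u| plus this error. *)
Definition skew_error (eta y u v : R) : R :=
  skew_beta beta gamma eta y * v + (1 + skew_delta beta gamma eta y) * `|u|.

Lemma skew_stepE eta y u v : skew_step beta gamma eta y u v =
  y + gamma * Num.sqrt eta * (y * skew_error eta y u v - y * `|u|).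
Proof. by rewrite /skew_step /skew_error; ring. Qed.

(** Write al for skew_alpha, which is c (beta - y^2) with c > 0, and s for
    sqrt (1 + al^2).  Then y^2 = beta - al / c is at most (beta + 1 / c) s^2, so
    |y| / s is bounded by K = sqrt (beta + 1 / c).  For al <= 0, s + al <= 1, so
    1 + skew_delta = (s + al) / s is at most 1 / s and the same bound applies.
    For al > 0, y^2 < beta and 1 + skew_delta <= 2. *)
Lemma skew_error_bound eta : 0 < eta ->
  exists2 K, 0 <= K & forall y u v, `|y * skew_error eta y u v| <= K * (`|v| + `|u|).
Proof.
move=> eta0.
pose c := Num.sqrt (pi / 2) * Num.sqrt eta / gamma.
have c0 : 0 < c by rewrite divr_gt0// mulr_gt0// sqrtr_gt0// divr_gt0// pi_gt0.
pose K := Num.sqrt (beta + c^-1).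
have bc0 : 0 <= beta + c^-1 by rewrite addr_ge0 ?invr_ge0 ?ltW.
exists (2 * K) => [|y u v]; first by rewrite mulr_ge0 ?sqrtr_ge0.
have alphaE : skew_alpha beta gamma eta y = c * (beta - y ^+ 2).
  by rewrite /skew_alpha /drift_ratio /c; field; rewrite gt_eqF.
rewrite /skew_error /skew_beta /skew_delta alphaE.
move: alphaE; set al := c * (beta - y ^+ 2) => _.
set s := Num.sqrt (1 + al ^+ 2).
have s2 : s ^+ 2 = 1 + al ^+ 2 by rewrite sqr_sqrtr// addr_ge0 ?sqr_ge0.
have s1 : 1 <= s.
  by rewrite -(@ler_pXn2r _ 2) ?nnegrE ?sqrtr_ge0// s2 expr1n lerDl sqr_ge0.
have s0 : 0 < s by exact: lt_le_trans s1.
have sal : `|al| <= s.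
  rewrite -(@ler_pXn2r _ 2) ?nnegrE ?sqrtr_ge0//.
  by rewrite real_normK ?num_real// s2 lerDr.
have yal : y ^+ 2 = beta - al / c by rewrite /al; field; rewrite gt_eqF.
have ys : `|y| <= K * s.
  rewrite -(@ler_pXn2r _ 2) ?nnegrE ?mulr_ge0 ?sqrtr_ge0//.
  rewrite real_normK ?num_real// exprMn sqr_sqrtr// s2 yal.
  have h1 : - al / c <= (1 + al ^+ 2) / c.
    rewrite ler_pM2r ?invr_gt0//; have := sqr_ge0 (1 + 2 * al); lra.
  have h2 : beta <= beta * (1 + al ^+ 2) 
    by rewrite mulrDr mulr1 lerDl mulr_ge0 ?sqr_ge0 ?ltW.
  by rewrite mulrDl; move: h1; rewrite mulNr [(_ + _) / c]mulrC; lra.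
have K0 : 0 <= K by exact: sqrtr_ge0.
have y2 : `|y| <= 2 * K * s by have := mulr_ge0 K0 (ltW s0); lra.
have b1 : `|y| * `|1 / s| <= 2 * K.
  by rewrite mul1r normfV (gtr0_norm s0) ler_pdivrMr.
have b2 : `|y| * `|1 + al / s| <= 2 * K.
  have -> : 1 + al / s = (s + al) / s by field; rewrite gt_eqF.
  rewrite normrM normfV (gtr0_norm s0) mulrA ler_pdivrMr//.
  have sal0 : 0 <= s + al by move: sal; rewrite ler_norml; lra.
  rewrite (ger0_norm sal0).
  have [al0|al0] := leP al 0.
    have sal1 : s + al <= 1.
      suff : s <= 1 - al by lra.
      have al1 : 0 <= 1 - al by lra.
      rewrite -(@ler_pXn2r _ 2) ?nnegrE ?(ltW s0)// s2.
      rewrite (_ : (1 - al) ^+ 2 = 1 + al ^+ 2 - 2 * al); last by ring.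
      lra.
    apply: (@le_trans _ _ `|y|); first by rewrite ler_piMr.
    exact: y2.
  have yK : `|y| <= K.
    rewrite -(@ler_pXn2r _ 2) ?nnegrE// real_normK ?num_real// sqr_sqrtr//.
    rewrite yal lerD2l (@le_trans _ _ 0)// ?invr_ge0 ?ltW//.
    by rewrite oppr_lt0 divr_gt0.
  have sals : s + al <= 2 * s by move: sal; rewrite ler_norml; lra.
  rewrite (_ : 2 * K * s = K * (2 * s)); last by ring.
  exact: ler_pM.
rewrite normrM mulrDr; apply: (@le_trans _ _
    (`|y| * (`|1 / s| * `|v| + `|1 + al / s| * `|u|))).
  rewrite ler_wpM2l//; apply: (le_trans (ler_normD _ _)).
  by rewrite !normrM normr_id.
by rewrite mulrDr !mulrA lerD// ler_wpM2r.
Qed.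

End skew_bounds.

Section skew_rate.
Context {R : realType}.
Variables (beta gamma h : R).
Hypotheses (beta0 : 0 < beta) (gamma0 : 0 < gamma) (h0 : 0 < h).

(** With E1, E2, Ec the errors of the two fine steps and of the coarse step
    multiplied by their starting points, the difference minus x times the limit
    is a E1 (1 - a |U2|) + a E2 - a sqrt 2 Ec, and each error is bounded
    uniformly in its starting point. *)
Lemma skew_rate (T : Type) (U1 U2 V1 V2 : T -> R) :
  exists2 K, 0 <= K & forall x w, 0 < x ->
  `|skew_diff beta gamma h U1 U2 V1 V2 x w / x
    - (noise_scale gamma h * (`|U1 w + U2 w| - `|U1 w| - `|U2 w|)
       + noise_scale gamma h ^+ 2 * `|U1 w| * `|U2 w|)| <=
  K * ((`|V1 w| + `|U1 w|) * (1 + `|U2 w|)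
       + (`|V2 w| + `|U2 w|) + (`|V1 w| + `|U1 w|)) / x.
Proof.
have [K1 K10 e1] := skew_error_bound beta0 gamma0 h0.
have [K2 K20 e2] := skew_error_bound beta0 gamma0 (divr_gt0 h0 (ltr0n _ 2)).
have a0 : 0 <= noise_scale gamma h by rewrite mulr_ge0 ?sqrtr_ge0 ?ltW.
have aE : gamma * Num.sqrt (h / 2) = noise_scale gamma h by [].
have cE := noise_scale_sqrt2 gamma (ltW h0).
move: (noise_scale gamma h) a0 aE cE => a a0 aE cE.
exists (a * K2 * (1 + a) + a * K1) => [|x w x0].
  by rewrite addr_ge0 ?mulr_ge0// addr_ge0.
set y := skew_step beta gamma (h / 2) x (U1 w) (V1 w).
set E1 := x * skew_error beta gamma (h / 2) x (U1 w) (V1 w).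
set E2 := y * skew_error beta gamma (h / 2) y (U2 w) (V2 w).
set Ec := x * skew_error beta gamma h x (coarse_noise U1 U2 w) (coarse_noise V1 V2 w).
have q0 : 0 < Num.sqrt 2 :> R by rewrite sqrtr_gt0.
have noiseE (Z1 Z2 : T -> R) : Num.sqrt 2 * `|coarse_noise Z1 Z2 w| = `|Z1 w + Z2 w|.
  by rewrite /coarse_noise normrM normfV (gtr0_norm q0) mulrC divfK ?gt_eqF.
have noise_le (Z1 Z2 : T -> R) :
    Num.sqrt 2 * `|coarse_noise Z1 Z2 w| <= `|Z1 w| + `|Z2 w|.
  by rewrite noiseE; exact: ler_normD.
have -> : skew_diff beta gamma h U1 U2 V1 V2 x w / x
    - (a * (`|U1 w + U2 w| - `|U1 w| - `|U2 w|) + a ^+ 2 * `|U1 w| * `|U2 w|) =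
    (a * E1 * (1 - a * `|U2 w|) + a * E2 - a * Num.sqrt 2 * Ec) / x.
  have yE : y = x + a * (E1 - x * `|U1 w|) by rewrite /y skew_stepE aE.
  have -> : skew_diff beta gamma h U1 U2 V1 V2 x w =
      y + a * (E2 - y * `|U2 w|)
      - (x + (a * Num.sqrt 2 * Ec - a * x * `|U1 w + U2 w|)).
    rewrite /skew_diff /skew_fine /skew_coarse -/y !skew_stepE aE cE -/E2 -/Ec.
    by rewrite -(noiseE U1 U2); ring.
  by rewrite yE; field; rewrite gt_eqF.
rewrite normrM normfV (gtr0_norm x0) ler_pM2r ?invr_gt0//.
have b1 := e2 x (U1 w) (V1 w); rewrite -/E1 in b1.
have b2 := e2 y (U2 w) (V2 w); rewrite -/E2 in b2.
have bc := e1 x (coarse_noise U1 U2 w) (coarse_noise V1 V2 w); rewrite -/Ec in bc.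
(* From here on only the bounds on the errors matter. *)
clearbody E1 E2 Ec.
(* Multiplied by sqrt 2, the coarse noise is a sum of two fine noises. *)
have qc : Num.sqrt 2 * `|Ec| <= K1 * ((`|V1 w| + `|U1 w|) + (`|V2 w| + `|U2 w|)).
  apply: (@le_trans _ _
      (Num.sqrt 2 * (K1 * (`|coarse_noise V1 V2 w| + `|coarse_noise U1 U2 w|)))).
    by rewrite ler_pM2l.
  rewrite mulrCA ler_wpM2l// mulrDr.
  have := noise_le V1 V2; have := noise_le U1 U2; lra.
have h1 : `|a * E1 * (1 - a * `|U2 w|)| <=
    a * K2 * (1 + a) * ((`|V1 w| + `|U1 w|) * (1 + `|U2 w|)).
  rewrite !normrM (ger0_norm a0).
  have l1 : `|1 - a * `|U2 w| | <= (1 + a) * (1 + `|U2 w|).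
    apply: (le_trans (ler_normB _ _)); rewrite normr1 normrM normr_id (ger0_norm a0).
    have := normr_ge0 (U2 w); have := mulr_ge0 a0 (normr_ge0 (U2 w)); nra.
  apply: (@le_trans _ _ ((a * (K2 * (`|V1 w| + `|U1 w|))) * ((1 + a) * (1 + `|U2 w|)))).
    by apply: ler_pM => //; rewrite ?mulr_ge0// ler_wpM2l.
  by rewrite le_eqVlt; apply/orP; left; apply/eqP; ring.
have h2 : `|a * E2| <= a * K2 * (`|V2 w| + `|U2 w|).
  by rewrite normrM (ger0_norm a0) -mulrA ler_wpM2l.
have h3 : `|a * Num.sqrt 2 * Ec| <= a * K1 * ((`|V1 w| + `|U1 w|) + (`|V2 w| + `|U2 w|)).
  by rewrite !normrM (ger0_norm a0) (gtr0_norm q0) -!mulrA ler_wpM2l.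
apply: (le_trans (ler_normB _ _)).
apply: (le_trans (lerD (le_trans (ler_normD _ _) (lerD h1 h2)) h3)).
have s1 : 0 <= `|V1 w| + `|U1 w| by rewrite addr_ge0.
have s2 : 0 <= `|V2 w| + `|U2 w| by rewrite addr_ge0.
have := normr_ge0 (U2 w).
move: (`|U2 w|) (`|V1 w| + `|U1 w|) (`|V2 w| + `|U2 w|) s1 s2 => u s t s1 s2 u0.
have ak2 := mulr_ge0 a0 K20; have ak1 := mulr_ge0 a0 K10.
have p1 : 0 <= a * K2 * (1 + a) * (s + t) - a * K2 * t.
  have -> : a * K2 * (1 + a) * (s + t) - a * K2 * t =
    a * K2 * s + a * K2 * a * (s + t) by ring.
  apply: addr_ge0; first exact: mulr_ge0.
  by apply: mulr_ge0; [exact: mulr_ge0|exact: addr_ge0].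
have p2 : 0 <= a * K1 * (s * (1 + u)).
  by apply: mulr_ge0 => //; apply: mulr_ge0 => //; exact: addr_ge0.
rewrite -subr_ge0.
have -> : (a * K2 * (1 + a) + a * K1) * (s * (1 + u) + t + s) -
  (a * K2 * (1 + a) * (s * (1 + u)) + a * K2 * t + a * K1 * (s + t)) =
  (a * K2 * (1 + a) * (s + t) - a * K2 * t) + a * K1 * (s * (1 + u)) by ring.
exact: addr_ge0.
Qed.

End skew_rate.

(** * Measurability of the schemes *)

Section measurability.
Context d (T : measurableType d) (R : realType).
Implicit Types f g k : T -> R.

(** On nonnegative reals the inverse is a real power. *)
Lemma measurable_fun_inv_ge0 f : measurable_fun setT f -> (forall w, 0 <= f w) ->
  measurable_fun setT (fun w => (f w)^-1).
Proof.
move=> mf f0.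
have -> : (fun w => (f w)^-1) = (fun w => f w `^ (-1)).
  by apply/funext => w; rewrite powR_inv1.
exact: (measurableT_comp (measurable_powR (-1 : R)) mf).
Qed.

Lemma measurable_fun_sqrt f : measurable_fun setT f -> (forall w, 0 <= f w) ->
  measurable_fun setT (fun w => Num.sqrt (f w)).
Proof.
move=> mf f0.
have -> : (fun w => Num.sqrt (f w)) = (fun w => f w `^ 2^-1).
  by apply/funext => w; rewrite powR12_sqrt.
exact: (measurableT_comp (measurable_powR (2^-1 : R)) mf).
Qed.

Variables (beta gamma eta : R).
Hypothesis eta0 : 0 <= eta.

Lemma measurable_tamed_step f g : measurable_fun setT f -> measurable_fun setT g ->
  measurable_fun setT (fun w => tamed_step beta gamma eta (f w) (g w)).
Proof.
move=> mf mg; rewrite /tamed_step.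
have mdrift : measurable_fun setT (fun w => drift beta (f w)).
  apply: measurable_funD; last exact: measurable_funM.
  by apply: measurable_funN; exact: measurable_funX.
apply: measurable_funD; last first.
  by apply: measurable_funM => //; apply: measurable_funM => //; exact: measurable_funM.
apply: measurable_funD => //; apply: measurable_funM; first exact: measurable_funM.
apply: measurable_fun_inv_ge0 => [|w]; last by rewrite addr_ge0 ?mulr_ge0.
apply: measurable_funD => //; apply: measurable_funM => //.
by apply: measurableT_comp => //; exact: normr_measurable.
Qed.

Lemma measurable_skew_step f g k : measurable_fun setT f -> measurable_fun setT g ->
  measurable_fun setT k ->
  measurable_fun setT (fun w => skew_step beta gamma eta (f w) (g w) (k w)).
Proof.
move=> mf mg mk; rewrite /skew_step.
have malpha : measurable_fun setT (fun w => skew_alpha beta gamma eta (f w)).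
  apply: measurable_funM => //; apply: measurable_funM => //.
  by apply: measurable_funB => //; exact: measurable_funX.
have minv : measurable_fun setT
    (fun w => (Num.sqrt (1 + skew_alpha beta gamma eta (f w) ^+ 2))^-1).
  apply: measurable_fun_inv_ge0 => [|w]; last exact: sqrtr_ge0.
  apply: measurable_fun_sqrt => [|w]; last by rewrite addr_ge0 ?sqr_ge0.
  by apply: measurable_funD => //; exact: measurable_funX.
apply: measurable_funD => //; apply: measurable_funM.
  by apply: measurable_funM => //; exact: measurable_funM.
apply: measurable_funD; apply: measurable_funM => //.
- exact: measurable_funM.
- exact: measurable_funM.
- by apply: measurableT_comp => //; exact: normr_measurable.
Qed.

End measurability.

(** * The limits for the two couplings *)

Theorem theorem2 (R : realType) (d : measure_display) (T : measurableType d)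
    (P : probability T R) (U1 U2 V1 V2 G1 G2 : {RV P >-> R})
    (hgauss : forall i : 'I_6,
       standard_gaussian (tnth [tuple U1; U2; V1; V2; G1; G2] i))
    (hindep : mutually_independent (tnth [tuple U1; U2; V1; V2; G1; G2]))
    (h gamma beta : R) (hh : 0 < h) (hgamma : 0 < gamma) (hbeta : 0 < beta) :
  let a : R := noise_scale gamma h in
  [/\ cvg_in_Lp P 2%:E (+oo : set_system R)
        (fun x w => tamed_diff beta gamma h G1 G2 x w / x)
        (fun w => a ^+ 2 * G1 w * G2 w),
      ((1 / x ^+ 2)%:E * 'V_P[tamed_diff beta gamma h G1 G2 x])%E
        @[x --> (+oo : set_system R)] --> (a ^+ 4)%:E,
      cvg_in_Lp P 2%:E (+oo : set_system R)
        (fun x w => skew_diff beta gamma h U1 U2 V1 V2 x w / x)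
        (fun w => a * (`|U1 w + U2 w| - `|U1 w| - `|U2 w|)
                  + a ^+ 2 * `|U1 w| * `|U2 w|) &
      ((1 / x ^+ 2)%:E * 'V_P[skew_diff beta gamma h U1 U2 V1 V2 x])%E
        @[x --> (+oo : set_system R)] -->
      ((2 - 16 / pi + 8 * Num.sqrt 2 / pi) * a ^+ 2
       + 2 * ((- 4 - pi + 4 * Num.sqrt 2) / pi `^ (3 / 2)) * a ^+ 3
       + (1 - 4 / pi ^+ 2) * a ^+ 4)%:E ].
Proof.
move=> a.
have gU1 : standard_gaussian U1 := hgauss (@Ordinal 6 0 isT).
have gU2 : standard_gaussian U2 := hgauss (@Ordinal 6 1 isT).
have gV1 : standard_gaussian V1 := hgauss (@Ordinal 6 2 isT).
have gV2 : standard_gaussian V2 := hgauss (@Ordinal 6 3 isT).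
have gG1 : standard_gaussian G1 := hgauss (@Ordinal 6 4 isT).
have gG2 : standard_gaussian G2 := hgauss (@Ordinal 6 5 isT).
have U12 : independent_pair U1 U2.
  exact: (mutually_independent_pair
    (i := @Ordinal 6 0 isT) (j := @Ordinal 6 1 isT) hindep).
have V1U2 : independent_pair V1 U2.
  exact: (mutually_independent_pair
    (i := @Ordinal 6 2 isT) (j := @Ordinal 6 1 isT) hindep).
have G12 : independent_pair G1 G2.
  exact: (mutually_independent_pair
    (i := @Ordinal 6 4 isT) (j := @Ordinal 6 5 isT) hindep).
have nU1 := Lfun2_gaussian_norm gU1.
have nU2 := Lfun2_gaussian_norm gU2.
have nV1 := Lfun2_gaussian_norm gV1.
have nV2 := Lfun2_gaussian_norm gV2.
have nG2 := Lfun2_gaussian_norm gG2.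
have mnoise (Z1 Z2 : {RV P >-> R}) : measurable_fun setT (coarse_noise Z1 Z2).
  by apply: measurable_funM => //; exact: measurable_funD.
have h2 : 0 <= h / 2 by rewrite divr_ge0 ?ltW.
have mtamed x : measurable_fun setT (tamed_diff beta gamma h G1 G2 x).
  apply: measurable_funB.
    apply: measurable_tamed_step => //; exact: measurable_tamed_step.
  by apply: measurable_tamed_step => //; exact: ltW.
have mskew x : measurable_fun setT (skew_diff beta gamma h U1 U2 V1 V2 x).
  apply: measurable_funB; apply: measurable_skew_step => //.
  exact: measurable_skew_step.
have tZ := product_limit_Lfun2 gG1 gG2 G12 (a ^+ 2).
have tW : (fun w => 3 + a * `|G2 w|) \in Lfun P 2%:E.
  by apply: Lfun2D; [exact: Lfun_cst|exact: Lfun2Z].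
have trate x w : 0 < x -> `|tamed_diff beta gamma h G1 G2 x w / x
    - a ^+ 2 * G1 w * G2 w| <= (3 + a * `|G2 w|) / x.
  by move=> x0; exact: tamed_rate.
have [K K0 srate] := skew_rate hbeta hgamma hh U1 U2 V1 V2.
have sZ := skew_limit_Lfun2 gU1 gU2 U12 a.
have sW : (fun w => K * ((`|V1 w| + `|U1 w|) * (1 + `|U2 w|)
       + (`|V2 w| + `|U2 w|) + (`|V1 w| + `|U1 w|))) \in Lfun P 2%:E.
  apply: Lfun2Z; apply: Lfun2D; last exact: Lfun2D.
  apply: Lfun2D; last exact: Lfun2D.
  under eq_fun do rewrite mulrDr mulr1 mulrDl.
  apply: Lfun2D; apply: Lfun2D => //.
    exact: Lfun2_gaussian_normM gV1 gU2 V1U2.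
  exact: Lfun2_gaussian_normM gU1 gU2 U12.
split.
- exact: rate_cvg_in_Lp2 mtamed tZ tW trate.
- rewrite (_ : a ^+ 4 = (a ^+ 2) ^+ 2); last by rewrite -exprM.
  apply: rate_cvg_variance mtamed tZ tW trate _ _.
  exact: variance_product_limit.
- exact: rate_cvg_in_Lp2 mskew sZ sW srate.
- apply: rate_cvg_variance mskew sZ sW srate _ _.
  exact: variance_skew_limit.
Qed.
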